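(* Let $p,q,N\ge1$, let $X_1,\dots,X_N\in\mathbb{R}^{p\times q}$ and $W_1,\dots,W_N\in\mathbb{R}_{>0}$, and let $X^{W}=\left(\frac{1}{\sqrt{W_1}}X_1,\dots,\frac{1}{\sqrt{W_N}}X_N\right)\in(\mathbb{R}^{p\times q})^N$. Let $G=\rho(GL_p\times GL_q)=\{A_2\otimes A_1\mid (A_1,A_2)\in GL_p\times GL_q\}\subseteq GL_{pq}$, regarded as a Zariski closed, self-adjoint group which is closed under non-zero scalar multiplication. Then $$\sup_{A\in G}\ell_c(A^\top A)\;=\;-\inf_{\alpha\in\mathbb{R}_{>0}}\left(\alpha\left(\inf_{B\in SL_p\times SL_q}\|B\cdot X^{W}\|^2\right)-pqN\log\alpha\right)$$ (as an equality of extended real numbers). The MLEs, if they exist, are the matrices $\alpha\, B_2^\top B_2\otimes B_1^\top B_1$, where $B=(B_1,B_2)$ minimizes $\|B\cdot X^{W}\|$ under the action of $SL_p\times SL_q$ on $(\mathbb{R}^{p\times q})^N$ and $\alpha\in\mathbb{R}_{>0}$ is the unique value minimizing the outer infimum. If $\alpha\, B_2^\top B_2\otimes B_1^\top B_1$, with such $B=(B_1,B_2)\in SL_p\times SL_q$ and $\alpha>0$, is an MLE given the sample, then all MLEs given the sample are of the form $\alpha\, S_2^\top B_2^\top B_2S_2\otimes S_1^\top B_1^\top B_1S_1$, where $(S_1,S_2)$ is in the $SL_p\times SL_q$-stabilizer of $X^{W}$. The stability under the left-right action of $SL_p\times SL_q$ on $(\mathbb{R}^{p\times q})^N$ is related to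 maximum likelihood estimation over $\mathcal{L}_G$ as follows: (a) $X^{W}$ is unstable $\iff$ $\ell_c(\Psi_1,\Psi_2)$ is not bounded from above; (b) $X^{W}$ is semistable $\iff$ $\ell_c(\Psi_1,\Psi_2)$ is bounded from above; (c) $X^{W}$ is polystable $\iff$ an MLE exists; (d) $X^{W}$ is stable $\implies$ a unique MLE exists.
   Context: All groups are over $\mathbb{R}$: $GL_m=GL_m(\mathbb{R})$, $SL_m=SL_m(\mathbb{R})$; $\rho:GL_p\times GL_q\to GL_{pq}$, $\rho(A_1,A_2)=A_2\otimes A_1$ (Kronecker product). $(X_1,\dots,X_N,W_1,\dots,W_N)$ is a (realized) sample from the joint distribution of $(X,W)$, where $X=\sqrt{W}Z$, $W\sim\mathrm{Exp}(1)$ and the $p\times q$ matrix normal variable $Z\sim\mathcal{MN}_{p,q}(0,\Sigma_1,\Sigma_2)$ are independent; thus $X$ has the matrix variate symmetric Laplace distribution with positive definite parameters $\Sigma_1\in\mathbb{R}^{p\times p}$, $\Sigma_2\in\mathbb{R}^{q\times q}$. Put $\Psi_1=\Sigma_1^{-1}$, $\Psi_2=\Sigma_2^{-1}$; the concentration matrix is $\Psi=\Psi_2\otimes\Psi_1$. The matrix Laplace group model is $\mathcal{L}_G=\{A^\top A\mid A\in G\}=\{(A_2^\top A_2)\otimes(A_1^\top A_1)\mid (A_1,A_2)\in GL_p\times GL_q\}$. The complete-data log-likelihood (up to an additive constant and a positive factor) is $$\ell_c(\Psi_1,\Psi_2)=N\log|\Psi_2\otimes\Psi_1|-\sum_{i=1}^N\frac1{W_i}\operatorname{tr}(\Psi_2X_i^\top\Psi_1X_i),$$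 where $|\cdot|$ is the determinant; for $A=A_2\otimes A_1\in G$, $\ell_c(A^\top A)$ denotes $\ell_c(A_1^\top A_1,A_2^\top A_2)$. An MLE is a matrix $\hat\Psi_2\otimes\hat\Psi_1\in\mathcal{L}_G$ maximizing $\ell_c$. The left-right action of $GL_p\times GL_q$ (and its subgroup $SL_p\times SL_q$) on $(\mathbb{R}^{p\times q})^N$ is $(A_1,A_2)\cdot X^W=\left(\frac1{\sqrt{W_1}}A_1X_1A_2^\top,\dots,\frac1{\sqrt{W_N}}A_1X_NA_2^\top\right)$, and $\|\cdot\|$ is the Frobenius norm, $\|(M_1,\dots,M_N)\|^2=\sum_i\|M_i\|_F^2$. Zariski closed means being the zero locus (in the general linear group) of a set of polynomials in the matrix entries; self-adjoint means closed under transpose. Stability: for a group $H$ acting linearly on a real vector space with Euclidean norm, a vector $v$ is (1) unstable if $0\in\overline{H\cdot v}$, i.e. $\inf_{h\in H}\|h\cdot v\|^2=0$; (2) semistable if $0\notin\overline{H\cdot v}$, i.e. $\inf_{h\in H}\|h\cdot v\|^2>0$; (3) polystable if $v\neq0$ and $H\cdot v$ is closed; (4) stable if $v$ is polystable and its stabilizer $H_v=\{h\in H\mid h\cdot v=v\}$ is finite. Here $H=SL_p\times SL_q$. *)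

(* Defs.v *)
From HB Require Import structures.
From mathcomp Require Import all_boot all_order all_algebra.
From mathcomp Require Import all_classical all_reals all_analysis.
From mathcomp Require Import mxtens.
From mathcomp Require mpoly.

Set Implicit Arguments.
Unset Strict Implicit.
Unset Printing Implicit Defensive.

Import Order.TTheory GRing.Theory Num.Theory.
Import numFieldNormedType.Exports.
Local Open Scope classical_set_scope.
Local Open Scope ring_scope.

(* The space of N-tuples of p x q matrices, with the product topology, i.e.
   the Euclidean topology of R^(p * q * N). *)
Notation mxtuple R p q N := {ptws 'I_N -> 'M[R]_(p, q)}.

Section MatrixGroups.
Variable R : realType.

Definition GL (n : nat) : set 'M[R]_n := [set A | A \in unitmx].

Definition SL (n : nat) : set 'M[R]_n := [set A | \det A = 1].

Arguments GL n _ : clear implicits.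
Arguments SL n _ : clear implicits.

(* [A *t B] is the Kronecker product, with blocks [A i j *: B]. *)
Definition rho (p q : nat) (A : 'M[R]_p * 'M[R]_q) : 'M[R]_(q * p) :=
  A.2 *t A.1.

Definition kron_group (p q : nat) : set 'M[R]_(q * p) :=
  [set rho A | A in GL p `*` GL q].

Definition matrix_group (n : nat) (G : set 'M[R]_n) : Prop :=
  [/\ G `<=` GL n, G 1%:M,
      forall A B, G A -> G B -> G (A *m B)
    & forall A, G A -> G (invmx A)].

(* A polynomial in the entries of a matrix is an [mpoly] in n * n variables,
   evaluated at the entries listed by [mxvec]. *)
Definition zariski_closed (n : nat) (G : set 'M[R]_n) : Prop :=
  exists P : set (mpoly.mpoly (n * n) R),
    G = [set A | A \in unitmx /\
                 forall f, P f -> mpoly.meval (fun k => mxvec A 0 k) f = 0].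

Definition self_adjoint (n : nat) (G : set 'M[R]_n) : Prop :=
  forall A, G A -> G A^T.

Definition scalar_closed (n : nat) (G : set 'M[R]_n) : Prop :=
  forall (c : R) A, c != 0 -> G A -> G (c *: A).

End MatrixGroups.

Arguments GL R n _ : clear implicits.
Arguments SL R n _ : clear implicits.
Arguments kron_group R p q _ : clear implicits.

Section Stability.
Variables (R : realType) (p q N : nat).
Variables (T : Type) (H : set T).
Variable act : T -> mxtuple R p q N -> mxtuple R p q N.

Definition orbit (v : mxtuple R p q N) : set (mxtuple R p q N) :=
  [set act h v | h in H].

Definition stabilizer (v : mxtuple R p q N) : set T :=
  [set h | H h /\ act h v = v].

Definition unstable (v : mxtuple R p q N) : Prop :=
  closure (orbit v) (fun=> 0).

Definition semistable (v : mxtuple R p q N) : Prop :=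
  ~ closure (orbit v) (fun=> 0).

Definition polystable (v : mxtuple R p q N) : Prop :=
  v <> (fun=> 0) /\ closed (orbit v).

Definition stable (v : mxtuple R p q N) : Prop :=
  polystable v /\ finite_set (stabilizer v).

End Stability.

Section Likelihood.
Variables (R : realType) (p q N : nat).

Definition frob_norm (v : mxtuple R p q N) : R :=
  Num.sqrt (\sum_(k < N) \sum_(i < p) \sum_(j < q) (v k i j) ^+ 2).

Definition left_right (A : 'M[R]_p * 'M[R]_q) (v : mxtuple R p q N) :
    mxtuple R p q N :=
  fun k => A.1 *m v k *m A.2^T.

Definition SLSL : set ('M[R]_p * 'M[R]_q) := SL R p `*` SL R q.

Variables (X : 'I_N -> 'M[R]_(p, q)) (W : 'I_N -> R).

Definition rescaled : mxtuple R p q N :=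
  fun k => (Num.sqrt (W k))^-1 *: X k.

Definition loglik (Psi1 : 'M[R]_p) (Psi2 : 'M[R]_q) : R :=
  N%:R * ln (\det (Psi2 *t Psi1))
  - \sum_(k < N) (W k)^-1 * \tr (Psi2 *m (X k)^T *m Psi1 *m X k).

(* The value of the log-likelihood at (rho A)^T *m rho A. *)
Definition loglik_gram (A : 'M[R]_p * 'M[R]_q) : R :=
  loglik (A.1^T *m A.1) (A.2^T *m A.2).

Definition is_MLE (Psi : 'M[R]_(q * p)) : Prop :=
  exists A, [/\ (GL R p `*` GL R q) A, Psi = (rho A)^T *m rho A
    & forall B, (GL R p `*` GL R q) B -> loglik_gram B <= loglik_gram A].

Definition norm_minimizer (B : 'M[R]_p * 'M[R]_q) : Prop :=
  SLSL B /\ forall C, SLSL C ->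
    frob_norm (left_right B rescaled) <= frob_norm (left_right C rescaled).

Definition inner_inf : \bar R :=
  ereal_inf [set ((frob_norm (left_right B rescaled)) ^+ 2)%:E | B in SLSL].

Definition outer_obj (alpha : R) : \bar R :=
  (alpha%:E * inner_inf - ((p * q * N)%:R * ln alpha)%:E)%E.

Definition outer_minimizer (alpha : R) : Prop :=
  0 < alpha /\ forall beta, 0 < beta -> (outer_obj alpha <= outer_obj beta)%E.

End Likelihood.

Arguments SLSL R p q _ : clear implicits.
Arguments left_right {R p q N} A v.

(* Main.v *)
Require Import Defs.

From HB Require Import structures.
From mathcomp Require Import all_boot all_order all_algebra.
From mathcomp Require Import all_classical all_reals all_analysis.
From mathcomp Require Import mxtens complex ring lra.
From mathcomp Require mpoly.
Import (canonicals) mpoly.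

(** The log-likelihood at [A] depends on [A] only through its Gram matrix.
    Up to a positive factor, a matrix of GL_n has the Gram matrix of a matrix
    of SL_n: diagonalize the Gram matrix and subtract the mean of the logarithms
    of its eigenvalues ([gram_SL_rescale]).  Hence the values of the
    log-likelihood are the numbers K ln alpha - alpha n(B), where K = pqN,
    alpha > 0, B is in SL_p x SL_q and n(B) is the squared norm of B.X^W
    ([GL_to_SL], [SL_to_GL]).  Maximizing such an expression decouples: n is to
    be minimized, and then a strictly concave function of alpha is to be
    maximized.  If m = inf n is positive the latter has its maximum at K / m
    only; if m = 0 it is unbounded.  This gives the formula for the supremum,
    the description of the maximum likelihood estimators, (a) and (b).

    The other claims are the Kempf-Ness theory of SL_p x SL_q acting on tuples
    of matrices.  It rests on the polar decomposition g = k exp(x), with k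
    orthogonal and x symmetric of trace 0: in the coordinates u of w with
    respect to the eigenvectors of x = (x1, x2), the squared norm of exp(x).w is
    the sum of the exp(2 (x1_i + x2_j)) u_kij^2 ([sqnorm_posexp]).

    Rigidity ([minimal_vector_rigid]): let w be of minimal norm in its orbit and
    exp(x).w be no longer than w.  Since exp(x/2).w is no shorter than w, the
    sum of the (1 - exp(x1_i + x2_j))^2 u_kij^2 is at most 0, so exp(s x) fixes
    w for every s.  Thus two minimal vectors of an orbit differ by an orthogonal
    element, which describes all the estimators in terms of one of them; and a
    finite stabilizer forces x = 0, which gives uniqueness in (d).

    For (c), a closed orbit contains a minimal vector by compactness.  That the
    orbit of a minimal vector w is closed ([minimal_vector_closed_orbit]) is the
    main point.  Let g_n.w tend to y, where g_n has the least Frobenius norm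
    among the elements of the group that move w to g_n.w.  If (g_n) is bounded,
    then a limit of it moves w to y.  Otherwise write g_n = k_n exp(x_n) with
    |x_n| tending to infinity, and let x be a limit of x_n / |x_n|.  The squared
    norm is convex along s |-> exp(s x_n).w, which forces exp(x).w to be no
    longer than w, so exp(-x/2) fixes w by rigidity.  But for large n the
    element g_n exp(-x/2) is shorter than g_n, because exp(-x/2) contracts the
    directions in which g_n expands most: this contradicts the choice of g_n.
    Compactness is used through an ultrafilter on nat that contains the
    cofinite sets: every bounded real sequence converges along it. *)

Set Implicit Arguments.
Unset Strict Implicit.
Unset Printing Implicit Defensive.

Import Order.TTheory GRing.Theory Num.Theory.
Import numFieldNormedType.Exports.
Local Open Scope classical_set_scope.
Local Open Scope ring_scope.

(** * Spectral theorem for real symmetric matrices *)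

Section Spectral.
Variable R : realType.

Definition orthogonal_mx n (l : 'M[R]_n) : Prop := l *m l^T = 1%:M.

Lemma orthogonal_mxV n (l : 'M[R]_n) : orthogonal_mx l -> l^T *m l = 1%:M.
Proof. exact: mulmx1C. Qed.

Lemma orthogonal_mx_tr n (l : 'M[R]_n) : orthogonal_mx l -> orthogonal_mx l^T.
Proof. by move=> /orthogonal_mxV; rewrite /orthogonal_mx trmxK. Qed.

Lemma orthogonal_mxM n (k l : 'M[R]_n) :
  orthogonal_mx k -> orthogonal_mx l -> orthogonal_mx (k *m l).
Proof.
by move=> ok ol; rewrite /orthogonal_mx trmx_mul mulmxA -(mulmxA k) ol mulmx1.
Qed.

Lemma rV_dotE n (v : 'rV[R]_n) : (v *m v^T) 0 0 = \sum_i v 0 i ^+ 2.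
Proof. by rewrite mxE; apply: eq_bigr => i _; rewrite mxE expr2. Qed.

Lemma rV_dot_gt0 n (v : 'rV[R]_n) : v != 0 -> 0 < (v *m v^T) 0 0.
Proof.
move=> v0; rewrite rV_dotE lt0r sumr_ge0 ?andbT; last by move=> *;
  exact: sqr_ge0.
apply: contra v0 => /eqP /psumr_eq0P s0; apply/eqP/rowP => i; rewrite mxE.
by apply/eqP; rewrite -sqrf_eq0; apply/eqP/s0 => // *; exact: sqr_ge0.
Qed.

(** The reflection exchanging [v] and the first basis vector [e] is the one
    in the hyperplane orthogonal to [e - v]. *)
Lemma householder n (v : 'rV[R]_n.+1) : v *m v^T = 1%:M ->
  exists2 h : 'M[R]_n.+1, orthogonal_mx h & row 0 h = v.
Proof.
move=> vv; set e : 'rV[R]_n.+1 := delta_mx 0 0.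
have ee : e *m e^T = 1%:M.
  by rewrite trmx_delta mul_delta_mx; apply/matrixP => i j; rewrite !mxE !ord1.
have [ev|ev] := eqVneq e v.
  by exists 1%:M; rewrite ?/orthogonal_mx ?trmx1 ?mulmx1 // row1.
set u := e - v; have u0 : u != 0 by rewrite subr_eq0.
set c := (u *m u^T) 0 0; have c0 : 0 < c by exact: rV_dot_gt0.
have uu : u *m u^T = c%:M by rewrite [LHS]mx11_scalar.
exists (1%:M - (2 / c) *: (u^T *m u)).
  rewrite /orthogonal_mx; set a := 2 / c; set P := u^T *m u.
  have PT : P^T = P by rewrite trmx_mul trmxK.
  have PP : P *m P = c *: P.
    by rewrite /P mulmxA -(mulmxA u^T) uu mul_mx_scalar -scalemxAl.
  rewrite linearB /= trmx1 [(a *: P)^T]linearZ /= PT mulmxBr mulmx1 mulmxBl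
    mul1mx.
  rewrite -scalemxAl -scalemxAr PP !scalerA.
  have ac : a * c = 2 by rewrite /a mulfVK ?gt_eqF.
  clearbody a P; apply/matrixP => i j; rewrite !mxE.
  by ring: ac.
rewrite rowE mulmxBr mulmx1 -/e -scalemxAr mulmxA.
have ve : v *m e^T = e *m v^T.
  by rewrite -[LHS]trmxK trmx_mul trmxK; apply/matrixP => i j;
    rewrite !ord1 mxE.
have -> : e *m u^T = (c / 2)%:M.
  have : u *m u^T = 2 *: (e *m u^T).
    rewrite /u linearB /= mulmxBl !mulmxBr ee vv ve; apply/matrixP => i j.
    by rewrite !mxE; ring.
  rewrite uu => /(congr1 (fun M => 2^-1 *: M)).
  rewrite scalerA mulVf ?pnatr_eq0 // scale1r => <-.
  by rewrite -[c%:M]scalemx1 scalerA scalemx1 mulrC.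
rewrite mul_scalar_mx scalerA; have -> : 2 / c * (c / 2) = 1.
  by field; rewrite gt_eqF.
by rewrite scale1r /u opprB addrC subrK.
Qed.

(** If v A = a v, then a |v|^2 = v A v^* is its own conjugate. *)
Lemma hermitian_eigenvalue_real (C : numClosedFieldType) n (A : 'M[C]_n) a :
  (forall i j, (A i j)^* = A j i) -> eigenvalue A a -> a \is Num.real.
Proof.
move=> Aij /eigenvalueP[v vA v0].
pose d := \sum_j v 0 j * (v 0 j)^*.
have d_neq0 : d != 0.
  apply: contra v0 => /eqP /psumr_eq0P d0; apply/eqP/rowP => j; rewrite mxE.
  apply/eqP; rewrite -mul_conjC_eq0; apply/eqP/d0 => // k _.
  exact: mul_conjC_ge0.
have ad : a * d = \sum_j \sum_i v 0 i * A i j * (v 0 j)^*.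
  rewrite mulr_sumr; apply: eq_bigr => j _; rewrite mulrA.
  by move/rowP: vA => /(_ j); rewrite !mxE => <-; rewrite mulr_suml.
have dr : d^* = d.
  by rewrite rmorph_sum; apply: eq_bigr => j _; rewrite rmorphM /= conjCK mulrC.
have : (a * d)^* = a * d.
  rewrite ad rmorph_sum exchange_big /=; apply: eq_bigr => j _.
  rewrite rmorph_sum; apply: eq_bigr => i _.
  by rewrite !rmorphM /= conjCK Aij [RHS]mulrC mulrA [RHS]mulrAC.
by rewrite rmorphM /= dr => /(mulIf d_neq0) /CrealP.
Qed.

Lemma real_symmetric_eigenvalue n (S : 'M[R]_n.+1) : S^T = S ->
  exists a, eigenvalue S a.
Proof.
move=> St; set A := map_mx (real_complex R) S.
have [a Aa] := eigenvalue_closed A (ltn0Sn n).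
have ra : a \is Num.real.
  apply: hermitian_eigenvalue_real Aa => i j.
  by rewrite !mxE -[in RHS]St mxE; exact: conjc_real.
exists (complex.Re a); rewrite eigenvalue_root_char.
move: Aa; rewrite eigenvalue_root_char -(RRe_real ra).
by rewrite /A -map_char_poly fmorph_root.
Qed.

(** Conjugating by an orthogonal matrix whose first row is an eigenvector
    splits off a 1 x 1 block. *)
Theorem real_spectral n (S : 'M[R]_n) : S^T = S ->
  exists l (d : 'rV[R]_n), orthogonal_mx l /\ S = l^T *m diag_mx d *m l.
Proof.
elim: n S => [|n IHn] S St.
  by exists 0, 0; split; apply/matrixP => -[].
have [a /eigenvalueP[w wS w0]] := real_symmetric_eigenvalue St.
have w_gt0 := rV_dot_gt0 w0.
pose v := (Num.sqrt ((w *m w^T) 0 0))^-1 *: w.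
have vv : v *m v^T = 1%:M.
  rewrite /v [(_ *: w)^T]linearZ /= -scalemxAl -scalemxAr scalerA -invfM -expr2.
  rewrite sqr_sqrtr ?ltW // [X in _ *: X]mx11_scalar -scalemx1 scalerA.
  by rewrite mulVf ?gt_eqF // scale1r.
have vS : v *m S = a *: v by rewrite -scalemxAl wS !scalerA mulrC.
have [h oh hv] := householder vv.
pose T : 'M[R]_(1 + n) := h *m S *m h^T.
have TT : T^T = T by rewrite !trmx_mul trmxK St mulmxA.
have T0 : row 0 T = a *: delta_mx 0 0.
  rewrite /T !row_mul hv vS -scalemxAl -hv -row_mul oh row1.
  by congr (_ *: _).
have defS : S = h^T *m T *m h.
  by rewrite /T !mulmxA (orthogonal_mxV oh) mul1mx -mulmxA (orthogonal_mxV oh)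
    mulmx1.
clearbody T.
have ursub_T : ursubmx T = 0.
  apply/matrixP => i j; rewrite !ord1 !mxE.
  move/rowP: T0 => /(_ (rshift 1 j)); rewrite mxE.
  rewrite (_ : lshift n 0 = 0) => [->|]; last exact/val_inj.
  by rewrite !mxE andbF mulr0.
have ulsub_T : ulsubmx T = a%:M.
  apply/matrixP => i j; rewrite !ord1 !mxE.
  rewrite (_ : lshift n 0 = 0); last exact/val_inj.
  by move/rowP: T0 => /(_ 0); rewrite mxE => ->; rewrite !mxE mulr1.
have dlsub_T : dlsubmx T = 0.
  by rewrite -[dlsubmx T]trmxK trmx_dlsub TT ursub_T trmx0.
have drT_sym : (drsubmx T)^T = drsubmx T by rewrite trmx_drsub TT.
have [l [d [ol drT]]] := IHn _ drT_sym.
pose m : 'M[R]_(1 + n) := block_mx 1%:M 0 0 l.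
have om : orthogonal_mx m.
  rewrite /orthogonal_mx /m tr_block_mx !trmx0 trmx1 mulmx_block.
  by rewrite !mulmx0 !mul0mx !addr0 !add0r mul1mx ol -scalar_mx_block.
exists (m *m h), (row_mx a%:M d); split; first exact: orthogonal_mxM.
have -> : diag_mx (row_mx a%:M d) = block_mx (a%:M : 'M[R]_1) 0 0 (diag_mx d).
  rewrite diag_mx_row; congr block_mx; apply/matrixP => i j.
  by rewrite !ord1 !mxE.
set D := block_mx _ _ _ _.
have defT : T = m^T *m D *m m.
  rewrite -[T]submxK ursub_T ulsub_T dlsub_T drT /m /D tr_block_mx !trmx0 trmx1.
  rewrite !mulmx_block !mulmx0 !mul0mx !addr0 !add0r.
  by rewrite !(mulmx0, mul0mx, mulmx1, mul1mx).
by rewrite defS defT trmx_mul !mulmxA.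
Qed.

End Spectral.

(** * Exponentials of symmetric matrices and polar decomposition *)

Section PolarDecomposition.
Variable R : realType.

(** The exponential of the symmetric matrix that has the rows of [l] as
    eigenvectors and the entries of [x] as eigenvalues.  Keeping [l] and [x]
    apart turns powers into multiples of [x], and limits into limits of [l] and
    [x]. *)
Definition posexp n (l : 'M[R]_n) (x : 'rV[R]_n) : 'M[R]_n :=
  l^T *m diag_mx (map_mx (@expR R) x) *m l.

Lemma posexp_tr n (l : 'M[R]_n) x : (posexp l x)^T = posexp l x.
Proof. by rewrite /posexp !trmx_mul trmxK tr_diag_mx mulmxA. Qed.

Lemma posexpD n (l : 'M[R]_n) x y : orthogonal_mx l ->
  posexp l x *m posexp l y = posexp l (x + y).
Proof.
move=> ol; rewrite /posexp -!mulmxA (mulmxA l) ol mul1mx (mulmxA (diag_mx _)).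
rewrite mulmx_diag; congr (_ *m (_ *m _)).
by congr diag_mx; apply/rowP => i; rewrite !mxE expRD.
Qed.

Lemma posexp0 n (l : 'M[R]_n) : orthogonal_mx l -> posexp l 0 = 1%:M.
Proof.
move=> ol; rewrite /posexp;
  have -> : map_mx (@expR R) (0 : 'rV[R]_n) = const_mx 1.
  by apply/rowP => i; rewrite !mxE expR0.
by rewrite diag_const_mx mulmx1 orthogonal_mxV.
Qed.

Lemma orthogonal_mx_det n (l : 'M[R]_n) : orthogonal_mx l -> \det l ^+ 2 = 1.
Proof. by move=> /(congr1 determinant);
  rewrite det_mulmx det_tr det1 expr2. Qed.

Lemma det_posexp n (l : 'M[R]_n) x : orthogonal_mx l ->
  \det (posexp l x) = expR (\sum_i x 0 i).
Proof.
move=> ol; rewrite /posexp !det_mulmx det_tr mulrAC -expr2.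
rewrite (orthogonal_mx_det ol) mul1r det_diag expR_sum.
by apply: eq_bigr => i _; rewrite mxE.
Qed.

(** The eigenvalues of A^T A are positive: they are the squared lengths of
    the rows of l A^T. *)
Lemma gram_posexp n (A : 'M[R]_n) : A \in unitmx ->
  exists l x, orthogonal_mx l /\ A^T *m A = posexp l x.
Proof.
move=> uA; have [|l [d [ol Ad]]] := @real_spectral _ _ (A^T *m A).
  by rewrite trmx_mul trmxK.
exists l, (map_mx (@ln R) d); split=> //; rewrite Ad /posexp -map_mx_comp.
congr (_ *m _ *m _); congr diag_mx; apply/rowP => i; rewrite mxE /= lnK //.
rewrite posrE; pose v := row i (l *m A^T).
have v0 : v != 0.
  rewrite /v rowE mulmxA; apply/eqP => /(congr1 (mulmx^~ (invmx A^T))).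
  rewrite mul0mx mulmxK ?unitmx_tr // => /(congr1 (mulmx^~ l^T)).
  rewrite mul0mx -mulmxA ol mulmx1 => /matrixP /(_ 0 i) /eqP.
  by rewrite !mxE !eqxx oner_eq0.
have lAl : (l *m A^T) *m (l *m A^T)^T = diag_mx d.
  rewrite trmx_mul trmxK -!mulmxA (mulmxA A^T) Ad !mulmxA ol mul1mx.
  by rewrite -mulmxA ol mulmx1.
have := rV_dot_gt0 v0; suff -> : (v *m v^T) 0 0 = d 0 i by [].
transitivity (diag_mx d i i); last by rewrite mxE eqxx mulr1n.
by rewrite -lAl /v; move: (l *m A^T) => M; rewrite !mxE;
  apply: eq_bigr => k _; rewrite !mxE.
Qed.

(** The exponential factor is the square root of A^T A.  The determinant 1
    of A^T A makes the trace of the logarithm vanish. *)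
Lemma polar_decomposition n (A : 'M[R]_n) : \det A = 1 ->
  exists (k l : 'M[R]_n) (x : 'rV[R]_n),
  [/\ orthogonal_mx k, orthogonal_mx l, \det k = 1,
    \sum_i x 0 i = 0 & A = k *m posexp l x].
Proof.
move=> A1; have uA : A \in unitmx by rewrite unitmxE A1 unitr1.
have [l [y [ol Ay]]] := gram_posexp uA.
pose x := 2^-1 *: y.
have y0 : expR (\sum_i y 0 i) = 1.
  by rewrite -(det_posexp y ol) -Ay det_mulmx det_tr A1 mulr1.
have x0 : \sum_i x 0 i = 0.
  have : \sum_i y 0 i = 0 by apply: expR_inj; rewrite y0 expR0.
  move=> s0; transitivity (2^-1 * \sum_i y 0 i); last by rewrite s0 mulr0.
  by rewrite mulr_sumr; apply: eq_bigr => i _; rewrite mxE.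
exists (A *m posexp l (- x)), l, x; split => //.
- rewrite /orthogonal_mx; apply: mulmx1C.
  rewrite trmx_mul posexp_tr -mulmxA (mulmxA A^T) Ay !posexpD //.
  by rewrite -(posexp0 ol); congr posexp; apply/rowP => i; rewrite !mxE; field.
- rewrite det_mulmx A1 mul1r det_posexp //.
  rewrite (eq_bigr (fun i => - x 0 i)) => [|i _]; last by rewrite mxE.
  by rewrite sumrN x0 oppr0 expR0.
- by rewrite -mulmxA posexpD // addNr posexp0 // mulmx1.
Qed.

End PolarDecomposition.

(** * The left-right action and vectors of minimal norm *)

Section MinimalVectors.
Variables (R : realType) (p q N : nat).
Local Notation V := (mxtuple R p q N).
Local Notation pairmx := ('M[R]_p * 'M[R]_q)%type.
Local Notation pairrV := ('rV[R]_p * 'rV[R]_q)%type.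
Implicit Types (v w : V) (A B C : pairmx) (x y : pairrV).

Definition sqnorm v : R := \sum_k \sum_i \sum_j v k i j ^+ 2.

Lemma sqnorm_ge0 v : 0 <= sqnorm v.
Proof. by do 3 (apply: sumr_ge0 => ? _); exact: sqr_ge0. Qed.

Lemma sqr_frob_norm v : frob_norm v ^+ 2 = sqnorm v.
Proof. by rewrite sqr_sqrtr // sqnorm_ge0. Qed.

Lemma ler_frob_norm v w : (frob_norm v <= frob_norm w) = (sqnorm v <= sqnorm w).
Proof. by rewrite -!sqr_frob_norm ler_sqr // nnegrE sqrtr_ge0. Qed.

Lemma sqnorm_entry v k i j : v k i j ^+ 2 <= sqnorm v.
Proof.
rewrite /sqnorm (bigD1 k) //= (bigD1 i) //= (bigD1 j) //= -!addrA lerDl.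
by rewrite !addr_ge0 //; repeat (apply: sumr_ge0 => ? _); rewrite ?sqr_ge0.
Qed.

Lemma sqnorm_eq0 v : sqnorm v = 0 -> v = (fun=> 0).
Proof.
move=> v0; apply/funext => k; apply/matrixP => i j; rewrite mxE.
apply/eqP; rewrite -sqrf_eq0 eq_le sqr_ge0 andbT -v0; exact: sqnorm_entry.
Qed.

Definition pair_mul A B : pairmx := (A.1 *m B.1, A.2 *m B.2).
Definition pair_inv A : pairmx := (invmx A.1, invmx A.2).
Definition pair_one : pairmx := (1%:M, 1%:M).
Definition pair_tr A : pairmx := (A.1^T, A.2^T).
Definition pair_orthogonal A := orthogonal_mx A.1 /\ orthogonal_mx A.2.
Definition pair_posexp A x : pairmx := (posexp A.1 x.1, posexp A.2 x.2).
Definition traceless x := \sum_i x.1 0 i = 0 /\ \sum_j x.2 0 j = 0.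

Lemma left_rightM A B v :
  left_right (pair_mul A B) v = left_right A (left_right B v).
Proof. by apply/funext => k; rewrite /left_right /= trmx_mul !mulmxA. Qed.

Lemma left_right1 v : left_right pair_one v = v.
Proof. by apply/funext => k; rewrite /left_right /= trmx1 mulmx1 mul1mx. Qed.

Lemma SLSL1 : SLSL R p q pair_one.
Proof. by split; rewrite /SL /= det1. Qed.

Lemma SLSLM A B : SLSL R p q A -> SLSL R p q B -> SLSL R p q (pair_mul A B).
Proof.
by move=> [a1 a2] [b1 b2]; split;
  rewrite /SL /= det_mulmx ?a1 ?a2 ?b1 ?b2 mulr1.
Qed.

Lemma SLSLV A : SLSL R p q A -> SLSL R p q (pair_inv A).
Proof. by move=> [a1 a2]; split; rewrite /SL /= det_inv ?a1 ?a2 invr1. Qed.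

Lemma SLSL_unit A : SLSL R p q A -> A.1 \in unitmx /\ A.2 \in unitmx.
Proof. by move=> [a1 a2]; rewrite !unitmxE a1 a2 unitr1. Qed.

Lemma pair_mul_assoc A B C : pair_mul A (pair_mul B C) =
  pair_mul (pair_mul A B) C.
Proof. by rewrite /pair_mul /= !mulmxA. Qed.

Lemma pair_mul1 A : pair_mul A pair_one = A.
Proof. by case: A => a b; rewrite /pair_mul /= !mulmx1. Qed.

Lemma pair_1mul A : pair_mul pair_one A = A.
Proof. by case: A => a b; rewrite /pair_mul /= !mul1mx. Qed.

Lemma pair_mulV A : SLSL R p q A -> pair_mul A (pair_inv A) = pair_one.
Proof. by move=> /SLSL_unit[? ?]; rewrite /pair_mul /= !mulmxV. Qed.

Lemma pair_Vmul A : SLSL R p q A -> pair_mul (pair_inv A) A = pair_one.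
Proof. by move=> /SLSL_unit[? ?]; rewrite /pair_mul /= !mulVmx. Qed.

Lemma left_rightK A v w : SLSL R p q A -> left_right A v = w ->
  left_right (pair_inv A) w = v.
Proof. by move=> HA <-; rewrite -left_rightM pair_Vmul // left_right1. Qed.

Lemma sqnorm_tr v : sqnorm v = \sum_k \tr (v k *m (v k)^T).
Proof.
apply: eq_bigr => k _; apply: eq_bigr => i _; rewrite mxE.
by apply: eq_bigr => j _; rewrite mxE expr2.
Qed.

Lemma sqnorm_orthogonal A v : pair_orthogonal A ->
  sqnorm (left_right A v) = sqnorm v.
Proof.
move=> [ho1 ho2]; rewrite !sqnorm_tr; apply: eq_bigr => k _;
  rewrite /left_right.
rewrite !trmx_mul trmxK -!mulmxA (mulmxA A.2^T) (orthogonal_mxV ho2) mul1mx.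
by rewrite mxtrace_mulC -!mulmxA (orthogonal_mxV ho1) mulmx1.
Qed.

Lemma pair_posexp0 A : pair_orthogonal A -> pair_posexp A 0 = pair_one.
Proof. by move=> [ho1 ho2]; rewrite /pair_posexp !posexp0. Qed.

Lemma traceless_scale s x : traceless x -> traceless (s *: x).
Proof.
move=> [x1 x2]; split.
  rewrite (eq_bigr (fun i => s * x.1 0 i)) => [|i _]; last by rewrite mxE.
  by rewrite -mulr_sumr x1 mulr0.
rewrite (eq_bigr (fun i => s * x.2 0 i)) => [|i _]; last by rewrite mxE.
by rewrite -mulr_sumr x2 mulr0.
Qed.

Lemma SLSL_posexp A x : pair_orthogonal A -> traceless x ->
  SLSL R p q (pair_posexp A x).
Proof.
by move=> [ho1 ho2] [x1 x2]; split; rewrite /SL /= det_posexp // ?x1 ?x2 expR0.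
Qed.

(** Rotating to the eigenvectors makes the action of an exponential
    diagonal. *)
Lemma left_right_posexp A x v : pair_orthogonal A ->
  left_right (pair_posexp A x) v = left_right (pair_tr A)
    (fun k => \matrix_(i, j) (expR (x.1 0 i + x.2 0 j) * left_right A v k i j)).
Proof.
move=> [ho1 ho2]; apply/funext => k; rewrite /left_right /=.
set u := A.1 *m v k *m A.2^T; set M := \matrix_(i, j) _.
have -> : M = diag_mx (map_mx (@expR R) x.1) *m u *m diag_mx (map_mx (@expR R)
  x.2).
  apply/matrixP => i j; rewrite mul_mx_diag mul_diag_mx /M !mxE expRD.
  by rewrite mulrAC.
by rewrite posexp_tr trmxK /posexp /u !mulmxA.
Qed.

Lemma sqnorm_posexp A x v : pair_orthogonal A ->
  sqnorm (left_right (pair_posexp A x) v) =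
  \sum_k \sum_i \sum_j expR (2 * (x.1 0 i + x.2 0 j)) * left_right A v k i j
    ^+ 2.
Proof.
move=> oA; rewrite left_right_posexp // sqnorm_orthogonal; last first.
  by case: oA => ho1 ho2; split; apply: orthogonal_mx_tr.
do 3 (apply: eq_bigr => ? _); rewrite mxE exprMn; congr (_ * _).
by rewrite expRM_natl.
Qed.

Definition minimal_vector w :=
  forall C, SLSL R p q C -> sqnorm w <= sqnorm (left_right C w).

(** Both ends of the path s |-> exp(s x).w have the minimal norm, and its
    midpoint is no shorter.  By strict convexity [x] can only act on the
    coordinates of [w] that vanish. *)
Lemma minimal_vector_rigid A x w : minimal_vector w -> pair_orthogonal A ->
  traceless x -> sqnorm (left_right (pair_posexp A x) w) <= sqnorm w ->
  forall s, left_right (pair_posexp A (s *: x)) w = w.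
Proof.
move=> wmin oA x0 xw; set u := left_right A w.
have wu : sqnorm w = \sum_k \sum_i \sum_j u k i j ^+ 2.
  by rewrite -/(sqnorm u) sqnorm_orthogonal.
have hmin := wmin _ (SLSL_posexp oA (traceless_scale 2^-1 x0)).
(* |w|^2 + |exp(x).w|^2 - 2 |exp(x/2).w|^2, written in the coordinates u *)
have key : \sum_k \sum_i \sum_j ((1 - expR (x.1 0 i + x.2 0 j)) * u k i j) ^+
  2 <= 0.
  have lin (a b c : R) : b <= a -> a <= c -> a + b - 2 * c <= 0 by lra.
  have := lin _ _ _ xw hmin.
  rewrite {1}wu !sqnorm_posexp // -/u; congr (_ <= _).
  rewrite mulr_sumr -big_split -sumrB /=; apply: eq_bigr => k _.
  rewrite mulr_sumr -big_split -sumrB /=; apply: eq_bigr => i _.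
  rewrite mulr_sumr -big_split -sumrB /=; apply: eq_bigr => j _.
  have -> : 2 * ((2^-1 *: x).1 0 i + (2^-1 *: x).2 0 j) = x.1 0 i + x.2 0 j.
    by rewrite !mxE; field.
  by rewrite expRM_natl; ring.
have fixed k i j : u k i j = 0 \/ x.1 0 i + x.2 0 j = 0.
  have : ((1 - expR (x.1 0 i + x.2 0 j)) * u k i j) ^+ 2 <= 0.
    apply: le_trans key; pose z : V := fun k => \matrix_(i, j)
      ((1 - expR (x.1 0 i + x.2 0 j)) * u k i j).
    have := sqnorm_entry z k i j; rewrite mxE => /le_trans; apply.
    rewrite le_eqVlt; apply/orP; left; apply/eqP.
    by do 3 (apply: eq_bigr => ? _); rewrite mxE.
  rewrite le_eqVlt ltNge sqr_ge0 orbF sqrf_eq0 mulf_eq0 => /orP[|/eqP];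
    last by left.
  by rewrite subr_eq0 -expR0 => /eqP /expR_inj/esym; right.
move=> s; rewrite left_right_posexp //.
have -> : (fun k => \matrix_(i, j) (expR ((s *: x).1 0 i + (s *: x).2 0 j)
    * left_right A w k i j)) = u :> V.
  apply/funext => k; apply/matrixP => i j; rewrite mxE -/u.
  have -> : (s *: x).1 0 i + (s *: x).2 0 j = s * (x.1 0 i + x.2 0 j).
    by rewrite !mxE mulrDr.
  by have [->|->] := fixed k i j; rewrite ?mulr0 // expR0 mul1r.
rewrite -left_rightM -[RHS]left_right1; congr left_right.
by case: oA => ho1 ho2; rewrite /pair_mul /= !orthogonal_mxV.
Qed.

Lemma pair_polar A : SLSL R p q A -> exists k l x,
  [/\ pair_orthogonal k /\ SLSL R p q k, pair_orthogonal l, traceless x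
    & A = pair_mul k (pair_posexp l x)].
Proof.
case: A => a b [/= /polar_decomposition[k1 [l1 [x1 [ok1 ol1 dk1 sx1 ->]]]]].
move=> /polar_decomposition[k2 [l2 [x2 [ok2 ol2 dk2 sx2 ->]]]].
by exists (k1, k2), (l1, l2), (x1, x2).
Qed.

End MinimalVectors.

(** * Entrywise limits of matrices *)

Section EntrywiseLimits.
Variable R : realType.
Context {T : Type} {F : set_system T} {FF : ProperFilter F}.

Lemma cvg_bigsum (I : Type) (r : seq I) (f : I -> T -> R) (l : I -> R) :
  (forall i, f i x @[x --> F] --> l i) ->
  \sum_(i <- r) f i x @[x --> F] --> \sum_(i <- r) l i.
Proof. by move=> fl; apply: cvg_big => //; exact: add_continuous. Qed.

Lemma cvg_bigprod (I : Type) (r : seq I) (f : I -> T -> R) (l : I -> R) :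
  (forall i, f i x @[x --> F] --> l i) ->
  \prod_(i <- r) f i x @[x --> F] --> \prod_(i <- r) l i.
Proof. by move=> fl; apply: cvg_big => //; exact: mul_continuous. Qed.

Lemma cvgR_unique (f : T -> R) (a b : R) :
  f @ F --> a -> f @ F --> b -> a = b.
Proof. by move=> fa fb; exact: (cvg_unique _ fa fb). Qed.

Definition mx_cvg m n (A : T -> 'M[R]_(m, n)) (L : 'M[R]_(m, n)) :=
  forall i j, A t i j @[t --> F] --> L i j.

Lemma mx_cvg_cst m n (L : 'M[R]_(m, n)) : mx_cvg (fun=> L) L.
Proof. by move=> i j; exact: cvg_cst. Qed.

Lemma mx_cvg_tr m n (A : T -> 'M[R]_(m, n)) L :
  mx_cvg A L -> mx_cvg (fun t => (A t)^T) L^T.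
Proof.
by move=> AL i j; rewrite mxE; under eq_fun do rewrite mxE; exact: AL.
Qed.

Lemma mx_cvg_mul m n k (A : T -> 'M[R]_(m, n)) (B : T -> 'M[R]_(n, k)) L M :
  mx_cvg A L -> mx_cvg B M -> mx_cvg (fun t => A t *m B t) (L *m M).
Proof.
move=> AL BM i j; rewrite mxE; under eq_fun do rewrite mxE.
by apply: cvg_bigsum => l; apply: cvgM; [exact: AL|exact: BM].
Qed.

Lemma mx_cvg_det n (A : T -> 'M[R]_n) L :
  mx_cvg A L -> \det (A t) @[t --> F] --> \det L.
Proof.
move=> AL; apply: cvg_bigsum => s; apply: cvgM; first exact: cvg_cst.
by apply: cvg_bigprod => i; exact: AL.
Qed.

Lemma mx_cvg_expdiag n (x : T -> 'rV[R]_n) (y : 'rV[R]_n) :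
  mx_cvg x y ->
  mx_cvg (fun t => diag_mx (map_mx (@expR R) (x t))) (diag_mx (map_mx (@expR
    R) y)).
Proof.
move=> xy i j; rewrite !mxE; under eq_fun do rewrite !mxE.
have [_|_] := eqVneq i j; rewrite ?mulr1n ?mulr0n; last first.
  under eq_fun do rewrite mulr0n; exact: cvg_cst.
under eq_fun do rewrite mulr1n.
by apply: continuous_cvg; [exact: continuous_expR|exact: xy].
Qed.

Lemma mx_cvg_posexp n (l : T -> 'M[R]_n) (x : T -> 'rV[R]_n) k y :
  mx_cvg l k -> mx_cvg x y -> mx_cvg (fun t => posexp (l t) (x t)) (posexp k y).
Proof.
move=> lk xy; apply: mx_cvg_mul => //; apply: mx_cvg_mul;
  first exact: mx_cvg_tr.
exact: mx_cvg_expdiag.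
Qed.

Lemma mx_cvg_unique m n (A : T -> 'M[R]_(m, n)) L M :
  mx_cvg A L -> mx_cvg A M -> L = M.
Proof.
move=> AL AM; apply/matrixP => i j.
by apply: (cvg_unique _ (AL i j) (AM i j)).
Qed.

Lemma mx_cvgP m n (A : T -> 'M[R]_(m, n)) L : A @ F --> L <-> mx_cvg A L.
Proof.
split=> [AL i j|AL].
  move=> B LB; suff : nbhs L [set M : 'M[R]_(m, n) | B (M i j)] by exact: AL.
  exists (fun i' j' => if (i' == i) && (j' == j) then B else setT).
    by move=> i' j'; case: ifP => [/andP[/eqP-> /eqP->] //|_]; exact: filterT.
  by move=> M /(_ i j); rewrite !eqxx.
move=> B [P LP PB].
have near_entries : F [set t | forall ij, P ij.1 ij.2 (A t ij.1 ij.2)].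
  by apply: filter_forall => ij; exact: AL (LP _ _).
have FB : F [set t | B (A t)].
  by apply: filterS near_entries => t At; apply: PB => i j; exact: (At (i, j)).
exact: FB.
Qed.

Lemma cvg_sqnorm p q N (x : T -> mxtuple R p q N) (y : mxtuple R p q N) :
  (forall k, mx_cvg (x^~ k) (y k)) -> sqnorm (x t) @[t --> F] --> sqnorm y.
Proof.
move=> xy; do 3 (apply: cvg_bigsum => ?).
by under eq_fun do rewrite expr2; rewrite expr2; apply: cvgM; exact: xy.
Qed.

Lemma cvg_left_right p q N (A : T -> 'M[R]_p * 'M[R]_q) B
    (v : mxtuple R p q N) :
  mx_cvg (fun t => (A t).1) B.1 -> mx_cvg (fun t => (A t).2) B.2 ->
  forall k, mx_cvg (fun t => left_right (A t) v k) (left_right B v k).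
Proof.
move=> A1 A2 k; apply: mx_cvg_mul; last exact: mx_cvg_tr.
by apply: mx_cvg_mul => //; exact: mx_cvg_cst.
Qed.

End EntrywiseLimits.

(** * The topology of tuples of matrices *)

Section Closure.
Variables (R : realType) (p q N : nat).
Local Notation V := (mxtuple R p q N).

(** There are finitely many entries, so the product topology is that of the
    Euclidean norm. *)
Lemma closure_sqnormP (S : set V) (y : V) :
  closure S y <->
  forall e, 0 < e -> exists2 v, S v & sqnorm (fun k => v k - y k) < e.
Proof.
split=> [Sy e e_gt0|Sy B By].
  have yk k : mx_cvg (F := nbhs y) (fun v : V => v k - y k) 0.
    have vk : mx_cvg (F := nbhs y) (fun v : V => v k) (y k).
      by apply/mx_cvgP; exact: (@proj_continuous 'I_N (fun=> 'M[R]_(p, q)) k y).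
    move=> i j.
    have -> : (fun v : V => (v k - y k) i j) = (fun v : V => v k i j - y k i j).
      by apply/funext => v; rewrite !mxE.
    rewrite [X in _ --> X]mxE -(subrr (y k i j)).
    by apply: cvgB; [exact: vk|exact: cvg_cst].
  have near_y : \forall v \near nbhs y,
      `|sqnorm ((fun=> 0) : V) - sqnorm (fun k => v k - y k)| < e.
    move: e e_gt0; apply/cvgrPdist_lt.
    exact: (cvg_sqnorm (F := nbhs y) (x := fun v k => v k - y k) yk).
  have [v [Sv /=]] := Sy _ near_y.
  have -> : sqnorm ((fun=> 0) : V) = 0.
    by do 3 (apply: big1 => ? _); rewrite mxE expr0n.
  rewrite sub0r normrN ger0_norm ?sqnorm_ge0 // => ve.
  by exists v.
pose F := filter_from [set e : R | 0 < e]
  (fun e => [set v : V | sqnorm (fun k => v k - y k) < e]).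
have FF : ProperFilter F.
  apply: filter_from_proper; last first.
    move=> e e0; exists y => /=; rewrite [sqnorm _]big1 // => k _.
    by do 2 (apply: big1 => ? _); rewrite subrr mxE expr0n.
  apply: filter_from_filter; first by exists 1 => /=; exact: ltr01.
  move=> a b /= a0 b0; exists (Num.min a b); first by rewrite /= lt_min a0.
  by move=> v /=; rewrite lt_min => /andP.
have Fy : F --> y.
  have Fyk k : mx_cvg (F := F) (fun v : V => v k) (y k).
    move=> i j; apply/cvgrPdist_lt => e e0.
    exists (e ^+ 2) => [|v /= ve]; first by rewrite /= exprn_gt0.
    rewrite distrC -(ltr_pXn2r (n := 2)) ?nnegrE ?(ltW e0) //.
    rewrite -normrX ger0_norm ?sqr_ge0 //; apply: le_lt_trans ve.
    have := sqnorm_entry ((fun k => v k - y k) : V) k i j.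
    by rewrite !mxE.
  apply/cvg_sup => k U [A [[W openW <-] Wy WU]].
  apply: filterS WU _; apply: (iffRL (mx_cvgP (F := F) _ _) (Fyk k)).
  exact: open_nbhs_nbhs.
have [e /= e0 eB] := Fy _ By.
by have [v Sv ve] := Sy _ e0; exists v; split => //; exact: eB.
Qed.
End Closure.

(** * Limits along ultrafilters *)

Section Ultralimits.
Variable R : realType.
Context {T : Type} {U : set_system T} {UU : UltraFilter U}.

(** A segment is compact, so there is a cluster point, and an ultrafilter
    converges to its cluster points. *)
Lemma ultra_cvg_bounded (f : T -> R) (M : R) :
  U [set t | `|f t| <= M] -> exists l : R, f @ U --> l.
Proof.
move=> UM.
have fM : (f @ U) `[- M, M]%classic.
  suff : U [set t | `[- M, M]%classic (f t)] by [].
  by apply: filterS UM => t /=; rewrite in_itv /= ler_norml.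
have [l [_ lU]] := @segment_compact R (- M) M (f @ U) _ fM.
exists l => B Bl.
have [//|UnB] := in_ultra_setVsetC (f @^-1` B) UU.
by have [z []] := lU (~` B) B UnB Bl.
Qed.

Lemma ultra_mx_cvg_bounded m n (A : T -> 'M[R]_(m, n)) (M : R) :
  (forall i j, U [set t | `|A t i j| <= M]) -> exists L, mx_cvg (F := U) A L.
Proof.
move=> AM.
have /choice[L AL] : forall ij : 'I_m * 'I_n,
    exists l : R, (fun t => A t ij.1 ij.2) @ U --> l.
  by move=> ij; exact: ultra_cvg_bounded (AM _ _).
by exists (\matrix_(i, j) L (i, j)) => i j; rewrite mxE; exact: (AL (i, j)).
Qed.

End Ultralimits.

(** * Minimizing sequences *)

Section MinimizingSequences.
Variable R : realType.

Lemma minimizing_sequence (T : Type) (S : set T) (c : T -> R) :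
  S !=set0 -> (forall t, 0 <= c t) ->
  exists m (s : nat -> T), [/\ forall n, S (s n), forall t, S t -> m <= c t
    & c (s n) @[n --> \oo] --> m].
Proof.
move=> [t0 St0] c_ge0; pose m := inf (c @` S).
have infS : has_inf (c @` S).
  by split; [exists (c t0), t0|exists 0 => _ [t _ <-]].
have mle t : S t -> m <= c t by move=> St; apply: inf_lbound;
  [case: infS|exists t].
have /choice[s sP] : forall n : nat, exists t, S t /\ c t < m + n.+1%:R^-1.
  move=> n; have n_gt0 : 0 < n.+1%:R^-1 :> R by rewrite invr_gt0.
  by have [_ [t St <-] ct] := inf_adherent n_gt0 infS; exists t.
exists m, s; split => //; first by move=> n; have [] := sP n.
apply/cvgrPdist_lt => e e_gt0.
near=> n; have [Ss sm] := sP n.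
rewrite distrC ger0_norm ?subr_ge0 ?mle // ltrBlDl (lt_trans sm) // ltrD2l.
near: n; exact: (near_infty_natSinv_lt (PosNum e_gt0)).
Unshelve. all: by end_near. Qed.

Lemma ultrafilter_nat :
  exists U : set_system nat, UltraFilter U /\ \oo `<=` U.
Proof. exact: ultraFilterLemma. Qed.

End MinimizingSequences.

(** * Attainment of minima *)

Section Attainment.
Variables (R : realType) (p q N : nat).
Local Notation V := (mxtuple R p q N).
Local Notation pairmx := ('M[R]_p * 'M[R]_q)%type.
Implicit Types (v w : V) (g h : pairmx).

Lemma closed_min_attained (S : set V) : S !=set0 -> closed S ->
  exists2 v, S v & forall w, S w -> sqnorm v <= sqnorm w.
Proof.
move=> S0 Scl.
have [m [s [Ss mS sm]]] := minimizing_sequence S0 (@sqnorm_ge0 R p q N).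
have [U [UU Uoo]] := ultrafilter_nat.
have {}sm : sqnorm (s n) @[n --> U] --> m by move=> B /sm; exact: Uoo.
have sbd : \forall n \near U, sqnorm (s n) <= m + 1.
  exact: cvgr_le m sm _ (ltr_pwDr ltr01 (lexx m)).
have /choice[y sy] : forall k, exists L, mx_cvg (F := U) (s^~ k) L.
  move=> k; apply: (@ultra_mx_cvg_bounded _ _ _ _ _ _ _ (Num.sqrt (m + 1))) =>
    i j.
  apply: filterS sbd => n /= sn; rewrite -sqrtr_sqr ler_wsqrtr //.
  by apply: le_trans sn; exact: sqnorm_entry.
have ym : sqnorm y = m.
  by apply: (cvgR_unique (F := U) _ sm); exact: cvg_sqnorm.
have Sy : S y.
  apply: Scl; apply/closure_sqnormP => e e_gt0.
  have dy k : mx_cvg (F := U) (fun n => s n k - y k) 0.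
    move=> i j; rewrite (_ : (fun n => _) = (fun n => s n k i j - y k i j)).
      rewrite [X in _ --> X]mxE -(subrr (y k i j)).
      by apply: cvgB; [exact: sy|exact: cvg_cst].
    by apply/funext => n; rewrite !mxE.
  have d0 : sqnorm ((fun=> 0) : V) = 0.
    by do 3 (apply: big1 => ? _); rewrite mxE expr0n.
  have cd := cvg_sqnorm (F := U) (x := fun n k => s n k - y k) dy.
  rewrite d0 in cd.
  have near_e : \forall n \near U, sqnorm (fun k => s n k - y k) < e.
    exact: cvgr_lt _ (cd _) _ e_gt0.
  by have [n ne] := filter_ex near_e; exists (s n).
by exists y => // w /mS; rewrite ym.
Qed.

Definition mx_sqnorm n (M : 'M[R]_n) := \tr (M^T *m M).
Definition pair_sqnorm g := mx_sqnorm g.1 + mx_sqnorm g.2.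

Lemma mx_sqnormE n (M : 'M[R]_n) : mx_sqnorm M = \sum_i \sum_j M i j ^+ 2.
Proof.
rewrite /mx_sqnorm mxtrace_mulC; apply: eq_bigr => i _; rewrite mxE.
by apply: eq_bigr => j _; rewrite mxE expr2.
Qed.

Lemma mx_sqnorm_entry n (M : 'M[R]_n) i j : M i j ^+ 2 <= mx_sqnorm M.
Proof.
rewrite mx_sqnormE (bigD1 i) //= (bigD1 j) //= -addrA lerDl.
by rewrite !addr_ge0 //; repeat (apply: sumr_ge0 => ? _); rewrite ?sqr_ge0.
Qed.

Lemma mx_sqnorm_ge0 n (M : 'M[R]_n) : 0 <= mx_sqnorm M.
Proof. by rewrite mx_sqnormE; do 2 (apply: sumr_ge0 => ? _);
  exact: sqr_ge0. Qed.

Lemma pair_sqnorm_ge0 g : 0 <= pair_sqnorm g.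
Proof. by rewrite addr_ge0 ?mx_sqnorm_ge0. Qed.

Lemma cvg_mx_sqnorm (T : Type) (F : set_system T) (FF : ProperFilter F)
    n (A : T -> 'M[R]_n) L :
  mx_cvg (F := F) A L -> mx_sqnorm (A t) @[t --> F] --> mx_sqnorm L.
Proof.
move=> AL; apply: cvg_bigsum => i.
by apply: mx_cvg_mul => //; exact: mx_cvg_tr.
Qed.

Lemma ultra_SLSL_cvg (T : Type) (U : set_system T) (UU : UltraFilter U)
    (g : T -> pairmx) (M : R) :
  (forall t, SLSL R p q (g t)) -> U [set t | pair_sqnorm (g t) <= M] ->
  exists2 h, SLSL R p q h & mx_cvg (F := U) (fun t => (g t).1) h.1 /\
                            mx_cvg (F := U) (fun t => (g t).2) h.2.
Proof.
move=> gSL gM.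
have [h1 gh1] : exists L, mx_cvg (F := U) (fun t => (g t).1) L.
  apply: (@ultra_mx_cvg_bounded _ _ _ _ _ _ _ (Num.sqrt M)) => i j.
  apply: filterS gM => n /= sn; rewrite -sqrtr_sqr ler_wsqrtr //.
  by apply: le_trans sn; rewrite ler_wpDr ?mx_sqnorm_ge0 ?mx_sqnorm_entry.
have [h2 gh2] : exists L, mx_cvg (F := U) (fun t => (g t).2) L.
  apply: (@ultra_mx_cvg_bounded _ _ _ _ _ _ _ (Num.sqrt M)) => i j.
  apply: filterS gM => n /= sn; rewrite -sqrtr_sqr ler_wsqrtr //.
  by apply: le_trans sn; rewrite ler_wpDl ?mx_sqnorm_ge0 ?mx_sqnorm_entry.
exists (h1, h2) => //; split; rewrite /SL /=.
  apply: (cvgR_unique (mx_cvg_det gh1)); rewrite (_ : (fun t => _) = fun=> 1).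
    exact: cvg_cst.
  by apply/funext => t; have [] := gSL t.
apply: (cvgR_unique (mx_cvg_det gh2)); rewrite (_ : (fun t => _) = fun=> 1).
  exact: cvg_cst.
by apply/funext => t; have [] := gSL t.
Qed.

(** The elements of the group that move [w] where [g] does form a closed
    set, on which the Frobenius norm has bounded sublevel sets. *)
Lemma shortest_representative w g : SLSL R p q g ->
  exists h, [/\ SLSL R p q h, left_right h w = left_right g w
    & forall f, SLSL R p q f -> left_right f w = left_right g w ->
      pair_sqnorm h <= pair_sqnorm f].
Proof.
move=> gSL.
pose S := [set f : pairmx | SLSL R p q f /\ left_right f w = left_right g w].
have [|m [s [Ss mS sm]]] :=
  @minimizing_sequence _ _ S pair_sqnorm _ pair_sqnorm_ge0.
  by exists g.
have [U [UU Uoo]] := ultrafilter_nat.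
have {}sm : pair_sqnorm (s n) @[n --> U] --> m by move=> B /sm; exact: Uoo.
have sbd : \forall n \near U, pair_sqnorm (s n) <= m + 1.
  exact: cvgr_le m sm _ (ltr_pwDr ltr01 (lexx m)).
have [h hSL [sh1 sh2]] := ultra_SLSL_cvg UU (fun n => (Ss n).1) sbd.
have hm : pair_sqnorm h = m.
  apply: (cvgR_unique (F := U) _ sm).
  by apply: cvgD; apply: cvg_mx_sqnorm.
exists h; split => // [|f fSL fw]; last by rewrite hm; apply: mS.
apply/funext => k.
have sh : mx_cvg (F := U) (fun n => left_right (s n) w k) (left_right h w k).
  exact: cvg_left_right.
apply: (mx_cvg_unique (F := U) sh).
rewrite (_ : (fun n => _) = fun=> left_right g w k); first exact: mx_cvg_cst.
by apply/funext => n; rewrite (Ss n).2.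
Qed.

End Attainment.

(** * Inequalities for exponentials *)

Section ExponentialSums.
Variable R : realType.
Context {T : Type} {U : set_system T} {UU : ProperFilter U}.

(** As [t] tends to infinity, the term of an index where [m] is positive
    dominates the terms where [m] is at most 0, whatever the signs of the
    latter; the other terms where [m] is positive are eventually nonnegative. *)
Lemma exponential_sum_gt0 (I : finType) (t : T -> R) (mu c : T -> I -> R)
    (m d : I -> R) (i0 : I) :
  (forall M, U [set n | M < t n]) ->
  (forall i, mu n i @[n --> U] --> m i) ->
  (forall i, c n i @[n --> U] --> d i) ->
  (forall i, 0 < m i -> 0 < d i) -> 0 < m i0 ->
  U [set n | 0 < \sum_i expR (2 * (t n * mu n i)) * c n i].
Proof.
move=> t_oo mu_m c_d d_gt0 m_gt0.
pose D := m i0 / 4; have D_gt0 : 0 < D by rewrite divr_gt0.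
have e_gt0 := d_gt0 _ m_gt0; pose K i := `|d i| + 1.
have K_ge0 i : 0 <= K i by rewrite addr_ge0.
have near_mu : \forall n \near U, forall i, m i <= 0 -> mu n i <= D.
  apply: filter_forall => i; case: (leP (m i) 0) => [mi|_]; last exact: nearW.
  by apply: filterS (cvgr_le _ (mu_m i) _ (le_lt_trans mi D_gt0)) => n.
have near_c : \forall n \near U, forall i, 0 < m i -> 0 <= c n i.
  apply: filter_forall => i; case: (ltP 0 (m i)) => [mi|_]; last exact: nearW.
  by apply: filterS (cvgr_ge _ (c_d i) _ (d_gt0 _ mi)) => n.
have near_K : \forall n \near U, forall i, - K i <= c n i.
  apply: filter_forall => i; apply: cvgr_ge _ (c_d i) _ _.
  by rewrite /K opprD ltrBlDr (le_lt_trans (lerNnormlW (lexx _))) // ltrDl.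
have near_mu0 : \forall n \near U, 3 * D <= mu n i0.
  by apply: cvgr_ge _ (mu_m i0) _ _; rewrite /D; lra.
have near_c0 : \forall n \near U, d i0 / 2 <= c n i0.
  by apply: cvgr_ge _ (c_d i0) _ _; lra.
pose B := (\sum_i K i) / (d i0 / 2) / (4 * D).
have : U [set n | (forall i, m i <= 0 -> mu n i <= D) /\
  (forall i, 0 < m i -> 0 <= c n i) /\ (forall i, - K i <= c n i) /\
  3 * D <= mu n i0 /\ d i0 / 2 <= c n i0 /\ B < t n].
  by do 5 (apply: filterI => //); exact: t_oo.
apply: filterS => n /= [h1 [h2 [h3 [h4 [h5 h6]]]]].
have B_ge0 : 0 <= B.
  by rewrite !divr_ge0 ?sumr_ge0 // ?mulr_ge0 // ?ltW // divr_gt0.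
have t_gt0 : 0 < t n by exact: le_lt_trans h6.
(* with D = m i0 / 4, a negative term has size O(exp(2 t D)), whereas the
   term of i0 is at least of order exp(6 t D) *)
have lower i : - (expR (2 * (t n * D)) * K i) <= expR (2 * (t n * mu n i)) * c
  n i.
  have [mi|mi] := leP (m i) 0; last first.
    rewrite (@le_trans _ _ 0) ?oppr_le0 ?mulr_ge0 ?expR_ge0 //.
    exact: h2.
  apply: (@le_trans _ _ (- (expR (2 * (t n * mu n i)) * K i))).
    rewrite lerN2 ler_wpM2r // ler_expR ler_wpM2l // ler_wpM2l ?(ltW t_gt0) //.
    exact: h1.
  by rewrite -mulrN ler_wpM2l ?expR_ge0.
rewrite (bigD1 i0) //=.
have rest : - (expR (2 * (t n * D)) * \sum_i K i) <=
    \sum_(i | i != i0) expR (2 * (t n * mu n i)) * c n i.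
  apply: (@le_trans _ _ (\sum_(i | i != i0) - (expR (2 * (t n * D)) * K i))).
    rewrite sumrN -mulr_sumr lerN2 ler_wpM2l ?expR_ge0 //.
    by rewrite [leRHS](bigD1 i0) //= lerDr.
  by apply: ler_sum => i _; exact: lower.
have main : expR (2 * (t n * D)) * (expR (4 * D * t n) * (d i0 / 2)) <=
    expR (2 * (t n * mu n i0)) * c n i0.
  rewrite mulrA -expRD ler_pM ?expR_ge0 ?divr_ge0 ?(ltW e_gt0) //.
  rewrite ler_expR; have := ler_wpM2l (ltW t_gt0) h4; lra.
apply: lt_le_trans (lerD main rest); rewrite -mulrBr mulr_gt0 ?expR_gt0 //.
rewrite subr_gt0 -ltr_pdivrMr ?divr_gt0 //.
apply: (@lt_le_trans _ _ (4 * D * t n)).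
  by move: h6; rewrite /B ltr_pdivrMr ?mulr_gt0 // [t n * _]mulrC.
by have := expR_ge1Dx (4 * D * t n); lra.
Qed.

(** Convexity of the exponential between 0 and t z: the tangent at [z]
    lies below the graph at 0 and at t z. *)
Lemma convex_expR_bound (t z : R) : 1 <= t ->
  expR z <= (1 - t^-1) + t^-1 * expR (t * z).
Proof.
move=> t_ge1; have t_gt0 : 0 < t by exact: lt_le_trans t_ge1.
have tangent u : expR z * (1 + (u - z)) <= expR u.
  have -> : expR u = expR z * expR (u - z) by rewrite -expRD addrC subrK.
  by rewrite ler_wpM2l ?expR_ge0 ?expR_ge1Dx.
have tV_ge0 : 0 <= t^-1 by rewrite invr_ge0 ltW.
have tV_le1 : 0 <= 1 - t^-1 by rewrite subr_ge0 invf_le1.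
have h0 := ler_wpM2l tV_le1 (tangent 0).
have h1 := ler_wpM2l tV_ge0 (tangent (t * z)).
rewrite expR0 mulr1 in h0; apply: le_trans (lerD h0 h1).
by rewrite le_eqVlt; apply/orP; left; apply/eqP; field; rewrite gt_eqF.
Qed.

End ExponentialSums.

(** * Frobenius norms of polar decompositions *)

Section OrbitClosed.
Variables (R : realType) (p q N : nat).
Local Notation V := (mxtuple R p q N).
Local Notation pairmx := ('M[R]_p * 'M[R]_q)%type.
Local Notation pairrV := ('rV[R]_p * 'rV[R]_q)%type.
Implicit Types (v w : V) (g h : pairmx) (x y : pairrV).

Lemma orthogonal_mx_entry n (l : 'M[R]_n) i j : orthogonal_mx l ->
  `|l i j| <= 1.
Proof.
move=> /matrixP/(_ i i); rewrite !mxE eqxx => l1.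
rewrite -(@ler_pXn2r _ 2) ?nnegrE // expr1n -normrX ger0_norm ?sqr_ge0 //
  -[leRHS]l1.
rewrite (bigD1 j) //= mxE -expr2 lerDl; apply: sumr_ge0 => k _.
by rewrite mxE -expr2 sqr_ge0.
Qed.

Lemma mx_cvg_orthogonal (T : Type) (F : set_system T) (FF : ProperFilter F)
    n (l : T -> 'M[R]_n) L :
  (forall t, orthogonal_mx (l t)) -> mx_cvg (F := F) l L -> orthogonal_mx L.
Proof.
move=> ol lL; apply: (mx_cvg_unique (F := F) (A := fun t => l t *m (l t)^T)).
  by apply: mx_cvg_mul => //; exact: mx_cvg_tr.
by rewrite (_ : (fun t => _) = fun=> 1%:M); [exact: mx_cvg_cst|exact/funext].
Qed.

Lemma mx_sqnorm_posexpM n (k l h : 'M[R]_n) (x y : 'rV[R]_n) :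
  orthogonal_mx k -> orthogonal_mx l -> orthogonal_mx h ->
  mx_sqnorm (k *m posexp l x *m posexp h y) =
  \sum_i expR (2 * x 0 i) * (l *m posexp h (2 *: y) *m l^T) i i.
Proof.
move=> ok ol oh.
have gen (E H : 'M[R]_n) : E^T = E -> H^T = H ->
    \tr ((k *m E *m H)^T *m (k *m E *m H)) = \tr ((E *m E) *m (H *m H)).
  move=> ET HT; rewrite !trmx_mul ET HT -!mulmxA (mulmxA k^T).
  by rewrite (orthogonal_mxV ok) mul1mx mxtrace_mulC -!mulmxA.
rewrite /mx_sqnorm (gen _ _ (posexp_tr _ _) (posexp_tr _ _)).
rewrite (posexpD x x ol) (posexpD y y oh).
rewrite -(mulr2n x) -(mulr2n y).
rewrite -(scaler_nat 2 x) -(scaler_nat 2 y).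
move: (posexp h _) => H; rewrite /posexp -!mulmxA mxtrace_mulC /mxtrace.
by apply: eq_bigr => i _; rewrite -mulmxA mul_diag_mx -!mulmxA !mxE.
Qed.

Lemma mx_sqnorm_posexp n (k l : 'M[R]_n) (x : 'rV[R]_n) :
  orthogonal_mx k -> orthogonal_mx l ->
  mx_sqnorm (k *m posexp l x) = \sum_i expR (2 * x 0 i).
Proof.
move=> ok ol; rewrite -[_ *m _]mulmx1 -(posexp0 ol) mx_sqnorm_posexpM //.
apply: eq_bigr => i _; rewrite scaler0 posexp0 // mulmx1 ol mxE eqxx.
by rewrite mulr1.
Qed.

Definition pair_l1norm x := \sum_i `|x.1 0 i| + \sum_j `|x.2 0 j|.

Lemma pair_l1norm_fst x i : `|x.1 0 i| <= pair_l1norm x.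
Proof.
rewrite /pair_l1norm (bigD1 i) //= -addrA lerDl.
by rewrite addr_ge0 // sumr_ge0.
Qed.

Lemma pair_l1norm_snd x j : `|x.2 0 j| <= pair_l1norm x.
Proof.
rewrite /pair_l1norm (bigD1 j) //= addrCA lerDl.
by rewrite addr_ge0 // sumr_ge0.
Qed.

Lemma pair_sqnorm_le k l x : pair_orthogonal k -> pair_orthogonal l ->
  pair_sqnorm (pair_mul k (pair_posexp l x)) <=
  expR (2 * pair_l1norm x) *+ (p + q) :> R.
Proof.
move=> [hk1 hk2] [hl1 hl2]; rewrite /pair_sqnorm !mx_sqnorm_posexp // mulrnDr.
have cst n (c : R) : c *+ n = \sum_(i < n) c by rewrite sumr_const card_ord.
rewrite (cst p) (cst q); apply: lerD.
  apply: ler_sum => i _.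
  by rewrite ler_expR ler_wpM2l // (le_trans (ler_norm _)) ?pair_l1norm_fst.
apply: ler_sum => i _.
by rewrite ler_expR ler_wpM2l // (le_trans (ler_norm _)) ?pair_l1norm_snd.
Qed.

Lemma traceless_pos x : traceless x -> 0 < pair_l1norm x ->
  (exists i, 0 < x.1 0 i) \/ (exists j, 0 < x.2 0 j).
Proof.
move=> [x1 x2] x_gt0; apply: contrapT => /not_orP[/forallNP n1 /forallNP n2].
move: x_gt0; rewrite /pair_l1norm.
rewrite (eq_bigr (fun i => - x.1 0 i)) => [|i _]; last first.
  by rewrite ler0_norm // leNgt; apply/negP.
rewrite [X in _ + X](eq_bigr (fun i => - x.2 0 i)) => [|i _]; last first.
  by rewrite ler0_norm // leNgt; apply/negP.
by rewrite !sumrN x1 x2 oppr0 addr0 ltxx.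
Qed.

Lemma orthogonal_conj_posexp n (l : 'M[R]_n) (x : 'rV[R]_n) :
  orthogonal_mx l ->
  l *m posexp l x *m l^T = diag_mx (map_mx (@expR R) x).
Proof. by move=> ol; rewrite /posexp !mulmxA ol mul1mx -mulmxA ol mulmx1. Qed.

(** The squared norm is convex along the path s |-> exp(s x).w, here taken
    at s = 0, 1 / t and 1. *)
Lemma sqnorm_posexp_convex l x w t : pair_orthogonal l -> 1 <= t ->
  sqnorm (left_right (pair_posexp l (t^-1 *: x)) w) <=
  sqnorm w + t^-1 * sqnorm (left_right (pair_posexp l x) w).
Proof.
move=> ol t_ge1; have t_gt0 : 0 < t by exact: lt_le_trans t_ge1.
rewrite -(sqnorm_orthogonal w ol) !sqnorm_posexp // /sqnorm.
set u := left_right l w.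
rewrite mulr_sumr -big_split /=; apply: ler_sum => k _.
rewrite mulr_sumr -big_split /=; apply: ler_sum => i _.
rewrite mulr_sumr -big_split /=; apply: ler_sum => j _.
have -> : 2 * (x.1 0 i + x.2 0 j) =
    t * (2 * ((t^-1 *: x).1 0 i + (t^-1 *: x).2 0 j)).
  by rewrite !mxE; field; rewrite gt_eqF.
move: (2 * _) => z; have u_ge0 := sqr_ge0 (u k i j).
apply: le_trans (ler_wpM2r u_ge0 (convex_expR_bound z t_ge1)) _.
by rewrite mulrDl mulrBl mul1r -mulrA lerD2r gerBl mulr_ge0 // invr_ge0 ltW.
Qed.

End OrbitClosed.

(** * Orbits of minimal vectors are closed *)

Section KempfNess.
Variables (R : realType) (p q N : nat).
Local Notation V := (mxtuple R p q N).
Local Notation pairmx := ('M[R]_p * 'M[R]_q)%type.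
Local Notation pairrV := ('rV[R]_p * 'rV[R]_q)%type.
Implicit Types (v w : V) (g h : pairmx) (x y : pairrV).

Lemma pair_l1normZ s x : pair_l1norm (s *: x) = `|s| * pair_l1norm x.
Proof.
rewrite /pair_l1norm mulrDr !mulr_sumr.
by congr (_ + _); apply: eq_bigr => i _; rewrite mxE normrM.
Qed.

(** In the limiting direction of g_n there is a one-parameter group that
    fixes [w], and going backwards along it shortens g_n. *)
Lemma unbounded_shortest_representatives w (U : set_system nat)
    (UU : UltraFilter U) (g : nat -> pairmx) (B : R) :
  minimal_vector w -> (forall n, SLSL R p q (g n)) ->
  U [set n | sqnorm (left_right (g n) w) <= B] ->
  (forall n h, SLSL R p q h -> left_right h w = left_right (g n) w ->
     pair_sqnorm (g n) <= pair_sqnorm h) ->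
  (forall M, U [set n | M < pair_sqnorm (g n)]) -> False.
Proof.
move=> wmin gSL gB gshort g_oo.
have /choice[K KP] n := pair_polar (gSL n).
have /choice[l lP] n := KP n; have /choice[x xP] n := lP n.
have {KP lP} Ko n : pair_orthogonal (K n) by have [[]] := xP n.
have lo n : pair_orthogonal (l n) by have [] := xP n.
have x0 n : traceless (x n) by have [] := xP n.
have gE n : g n = pair_mul (K n) (pair_posexp (l n) (x n)) by have [] := xP n.
move=> {xP}; pose t n := pair_l1norm (x n).
have t_oo M : U [set n | M < t n].
  apply: filterS (g_oo (expR (2 * M) *+ (p + q))) => n /= gM.
  rewrite ltNge; apply/negP => tM; move: gM; apply/negP; rewrite -leNgt gE.
  apply: le_trans (pair_sqnorm_le _ (Ko n) (lo n)) _.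
  by rewrite lerMn2r ler_expR ler_wpM2l // orbT.
pose mu n : pairrV := (t n)^-1 *: x n.
have mu1_le i j : U [set n | `|(mu n).1 i j| <= 1].
  apply: filterS (t_oo 0) => n /= tn; rewrite mxE normrM normfV (gtr0_norm tn).
  by rewrite mulrC ler_pdivrMr // mul1r ord1 pair_l1norm_fst.
have mu2_le i j : U [set n | `|(mu n).2 i j| <= 1].
  apply: filterS (t_oo 0) => n /= tn; rewrite mxE normrM normfV (gtr0_norm tn).
  by rewrite mulrC ler_pdivrMr // mul1r ord1 pair_l1norm_snd.
have [m1 mu_m1] := ultra_mx_cvg_bounded mu1_le.
have [m2 mu_m2] := ultra_mx_cvg_bounded mu2_le.
have l1_le i j : U [set n | `|(l n).1 i j| <= 1].
  by apply: nearW => n; apply: orthogonal_mx_entry; case: (lo n).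
have l2_le i j : U [set n | `|(l n).2 i j| <= 1].
  by apply: nearW => n; apply: orthogonal_mx_entry; case: (lo n).
have [k1 l_k1] := ultra_mx_cvg_bounded l1_le.
have [k2 l_k2] := ultra_mx_cvg_bounded l2_le.
pose k : pairmx := (k1, k2); pose m : pairrV := (m1, m2).
have ko : pair_orthogonal k.
  split; [apply: mx_cvg_orthogonal l_k1|apply: mx_cvg_orthogonal l_k2] => n.
    by case: (lo n).
  by case: (lo n).
have m0 : traceless m.
  split.
    apply: (cvgR_unique (F := U) (f := fun n => \sum_i (mu n).1 0 i)).
      by apply: cvg_bigsum => i; exact: mu_m1.
    rewrite (_ : (fun n => _) = fun=> 0); first exact: cvg_cst.
    by apply/funext => n; have [] := traceless_scale (t n)^-1 (x0 n).
  apply: (cvgR_unique (F := U) (f := fun n => \sum_i (mu n).2 0 i)).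
    by apply: cvg_bigsum => i; exact: mu_m2.
  rewrite (_ : (fun n => _) = fun=> 0); first exact: cvg_cst.
  by apply/funext => n; have [] := traceless_scale (t n)^-1 (x0 n).
(* the directions mu_n are normalized, so their limit m is nonzero *)
have m_norm : pair_l1norm m = 1.
  apply: (cvgR_unique (F := U) (f := fun n => pair_l1norm (mu n))).
    by apply: cvgD; apply: cvg_bigsum => i; apply: cvg_norm;
      [exact: mu_m1|exact: mu_m2].
  apply: cvg_near_cst; apply: filterS (t_oo 0) => n /= tn.
  by rewrite pair_l1normZ normfV gtr0_norm // mulVf ?gt_eqF.
(* exp(mu_n).w lies at the parameter 1 / t_n, which tends to 0, of the path
   from w to exp(x_n).w, and the latter has the bounded norm of g_n.w *)
have km_le : sqnorm (left_right (pair_posexp k m) w) <= sqnorm w.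
  have cv : sqnorm (left_right (pair_posexp (l n) (mu n)) w) @[n --> U] -->
      sqnorm (left_right (pair_posexp k m) w).
    apply: cvg_sqnorm => a.
    apply: (cvg_left_right (F := U) (A := fun n => pair_posexp (l n) (mu n))).
      exact: mx_cvg_posexp.
    exact: mx_cvg_posexp.
  apply/ler_addgt0Pr => e e_gt0.
  rewrite leNgt; apply/negP => lt_e.
  have [n [/= h1 [h2 [h3 gBn]]]] := filter_ex (filterI (cvgr_gt _ cv _ lt_e)
    (filterI (t_oo 1) (filterI (t_oo (B / e)) gB))).
  have t_gt0 : 0 < t n by exact: lt_trans h2.
  have := sqnorm_posexp_convex (x n) w (lo n) (ltW h2).
  apply/negP; rewrite -ltNge; apply: le_lt_trans h1; rewrite lerD2l.
  rewrite mulrC ler_pdivrMr // mulrC -ler_pdivrMr //.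
  apply: le_trans (ltW h3); rewrite ler_wpM2r ?invr_ge0 ?(ltW e_gt0) //.
  by move: gBn; rewrite gE left_rightM sqnorm_orthogonal.
have fixw := minimal_vector_rigid wmin ko m0 km_le.
(* h fixes w, so g_n h is a competitor of g_n *)
pose h := pair_posexp k ((- 2^-1) *: m).
have hSL : SLSL R p q h by apply: SLSL_posexp => //; exact: traceless_scale.
have hle n : pair_sqnorm (g n) <= pair_sqnorm (pair_mul (g n) h).
  apply: gshort; first exact: SLSLM.
  by rewrite left_rightM fixw.
pose c1 n := (l n).1 *m posexp k1 (- m1) *m (l n).1^T.
pose c2 n := (l n).2 *m posexp k2 (- m2) *m (l n).2^T.
have c1m : mx_cvg (F := U) c1 (diag_mx (map_mx (@expR R) (- m1))).
  rewrite -(orthogonal_conj_posexp _ ko.1); apply: mx_cvg_mul;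
    last exact: mx_cvg_tr.
  by apply: mx_cvg_mul => //; exact: mx_cvg_cst.
have c2m : mx_cvg (F := U) c2 (diag_mx (map_mx (@expR R) (- m2))).
  rewrite -(orthogonal_conj_posexp _ ko.2); apply: mx_cvg_mul;
    last exact: mx_cvg_tr.
  by apply: mx_cvg_mul => //; exact: mx_cvg_cst.
(* |g_n|^2 - |g_n h|^2 is a sum, over the eigenvalues of both components, of
   exp(2 t_n mu_n i) (1 - c_n i i) *)
pose J := ('I_p + 'I_q)%type.
pose muJ n (a : J) := match a with inl i => (mu n).1 0 i | inr j =>
  (mu n).2 0 j end.
pose mJ (a : J) := match a with inl i => m1 0 i | inr j => m2 0 j end.
pose cJ n (a : J) := 1 - match a with inl i => c1 n i i | inr j => c2 n j j end.
pose dJ (a : J) := 1 - expR (- mJ a).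
have [a0 a0_gt0] : exists a, 0 < mJ a.
  have m_gt0 : 0 < pair_l1norm m by rewrite m_norm.
  by have [[i ?]|[j ?]] := traceless_pos m0 m_gt0;
    [exists (inl i)|exists (inr j)].
have muJ_cvg a : muJ n a @[n --> U] --> mJ a.
  by case: a => i; [exact: mu_m1|exact: mu_m2].
have cJ_cvg a : cJ n a @[n --> U] --> dJ a.
  case: a => i; apply: cvgB; try exact: cvg_cst.
    by have := c1m i i; rewrite !mxE eqxx mulr1n.
  by have := c2m i i; rewrite !mxE eqxx mulr1n.
have dJ_gt0 a : 0 < mJ a -> 0 < dJ a.
  by move=> ma; rewrite /dJ subr_gt0 expR_lt1 oppr_lt0.
have [n /= [+ tn]] := filter_ex (filterI
  (exponential_sum_gt0 t_oo muJ_cvg cJ_cvg dJ_gt0 a0_gt0) (t_oo 0)).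
apply/negP; rewrite -leNgt; have [[K1 K2] [L1 L2]] := (Ko n, lo n).
have xE : x n = t n *: mu n by rewrite /mu scalerA mulfV ?scale1r ?gt_eqF.
have E1 : pair_sqnorm (g n) =
    \sum_i expR (2 * (x n).1 0 i) + \sum_j expR (2 * (x n).2 0 j).
  by rewrite gE /pair_sqnorm !mx_sqnorm_posexp.
have half (r : nat) (y : 'rV[R]_r) : 2 *: (- 2^-1 *: y) = - y.
  by rewrite scalerA mulrN mulfV ?pnatr_eq0 // scaleN1r.
have E2 : pair_sqnorm (pair_mul (g n) h) =
    \sum_i expR (2 * (x n).1 0 i) * c1 n i i +
    \sum_j expR (2 * (x n).2 0 j) * c2 n j j.
  rewrite gE /pair_sqnorm !mx_sqnorm_posexpM ?half //.
    by case: ko.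
  by case: ko.
have := hle n; rewrite E1 E2 -subr_ge0 => h_ge0.
rewrite big_sumType /= -oppr_ge0; apply: le_trans h_ge0 _.
rewrite le_eqVlt; apply/orP; left; apply/eqP.
rewrite opprD addrACA -!sumrB [in RHS]opprD -!sumrN.
congr (_ + _); apply: eq_bigr => i _.
  have -> : (x n).1 0 i = t n * (mu n).1 0 i by rewrite {1}xE mxE.
  by rewrite /cJ; ring.
have -> : (x n).2 0 i = t n * (mu n).2 0 i by rewrite {1}xE mxE.
by rewrite /cJ; ring.
Qed.

(** An element of the closure is a limit of g_n.w with g_n as short as
    possible; such a sequence is bounded along the ultrafilter, hence has a
    limit in the group. *)
Theorem minimal_vector_closed_orbit w :
  minimal_vector w -> closed (Defs.orbit (SLSL R p q) left_right w).
Proof.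
move=> wmin y /closure_sqnormP yS.
have /choice[g gP] : forall n : nat, exists g, [/\ SLSL R p q g,
    sqnorm (fun k => left_right g w k - y k) < n.+1%:R^-1
  & forall h, SLSL R p q h -> left_right h w = left_right g w ->
      pair_sqnorm g <= pair_sqnorm h].
  move=> n; have n_gt0 : 0 < n.+1%:R^-1 :> R by rewrite invr_gt0.
  have [_ [f fSL <-] fy] := yS _ n_gt0.
  have [h [hSL hf hmin]] := shortest_representative w fSL.
  by exists h; split => //; rewrite hf.
have [U [UU Uoo]] := ultrafilter_nat.
have gy k : mx_cvg (F := U) (fun n => left_right (g n) w k) (y k).
  move=> i j.
  suff to_y : (fun n => left_right (g n) w k i j) @ \oo --> y k i j.
    by move=> B /to_y; exact: Uoo.
  apply/cvgrPdist_lt => e e_gt0; near=> n.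
  have [_ gn _] := gP n.
  rewrite distrC -(ltr_pXn2r (n := 2)) ?nnegrE ?(ltW e_gt0) //.
  rewrite -normrX ger0_norm ?sqr_ge0 //.
  have := sqnorm_entry ((fun k => left_right (g n) w k - y k) : V) k i j.
  rewrite !mxE => /le_lt_trans; apply; apply: lt_trans gn _.
  near: n; apply: (near_infty_natSinv_lt (PosNum (exprn_gt0 2 e_gt0))).
have [[M gM]|g_oo] := pselect (exists M, U [set n | pair_sqnorm (g n) <= M]).
  have [h hSL [gh1 gh2]] := ultra_SLSL_cvg UU (fun n =>
    let: And3 a _ _ := gP n in a) gM.
  exists h => //; apply/funext => k; apply: (mx_cvg_unique (F := U) _ (gy k)).
  exact: cvg_left_right.
exfalso.
have gy_norm : sqnorm (left_right (g n) w) @[n --> U] --> sqnorm y.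
  exact: (cvg_sqnorm (x := fun n => left_right (g n) w) gy).
have near_B : \forall n \near U, sqnorm (left_right (g n) w) <= sqnorm y + 1.
  exact: cvgr_le _ gy_norm _ (ltr_pwDr ltr01 (lexx _)).
apply: (@unbounded_shortest_representatives w U UU g (sqnorm y + 1)) => //.
- by move=> n; have [] := gP n.
- by move=> n h; have [_ _] := gP n; exact.
- move=> M; have [gM|] := in_ultra_setVsetC [set n | pair_sqnorm (g n) <= M] UU.
    by case: g_oo; exists M.
  by apply: filterS => n /= /negP; rewrite -ltNge.
Unshelve. all: by end_near.
Qed.

End KempfNess.

(** * Kronecker products of invertible matrices *)

Section KroneckerGroup.
Variable R : realType.

Lemma tens1mx m n : (1%:M : 'M[R]_m) *t (1%:M : 'M[R]_n) = 1%:M.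
Proof.
apply/matrixP => i j.
case: (mxtens_indexP i) => i1 i2; case: (mxtens_indexP j) => j1 j2.
rewrite tensmxE !mxE -natrM mulnb.
by rewrite (can_eq (@mxtens_indexK m n)) xpair_eqE.
Qed.

Lemma tensmxZ m n m' n' (a b : R) (A : 'M[R]_(m, n)) (B : 'M[R]_(m', n')) :
  (a *: A) *t (b *: B) = (a * b) *: (A *t B).
Proof. by apply/matrixP => i j; rewrite !mxE mulrACA. Qed.

Lemma invmx_tens m n (A : 'M[R]_m) (B : 'M[R]_n) : A \in unitmx ->
  B \in unitmx ->
  A *t B \in unitmx /\ invmx (A *t B) = invmx A *t invmx B.
Proof.
move=> uA uB; have AB1 : (invmx A *t invmx B) *m (A *t B) = 1%:M.
  by rewrite tensmx_mul !mulVmx // tens1mx.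
have uAB : A *t B \in unitmx by have [] := mulmx1_unit AB1.
by split=> //; rewrite -[RHS](mulmxK uAB) AB1 mul1mx.
Qed.

(** A row killed by one factor, tensored with a basis row, is killed by the
    product. *)
Lemma unitmx_tens m n (A : 'M[R]_m) (B : 'M[R]_n) : (0 < m)%N -> (0 < n)%N ->
  A *t B \in unitmx -> A \in unitmx /\ B \in unitmx.
Proof.
case: m A => // m A _; case: n B => // n B _ uAB; split; apply: contraT.
  rewrite unitmxE unitfE negbK => /det0P[v v0 vA].
  have /(congr1 (mulmx^~ (invmx (A *t B)))) :
      (v *t delta_mx 0 0 : 'M[R]_(1 * 1, m.+1 * n.+1)) *m (A *t B) = 0.
    by rewrite tensmx_mul vA tens0mx.
  rewrite mulmxK // mul0mx => vd; case/eqP: v0; apply/rowP => i.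
  move/matrixP: vd => /(_ (mxtens_index (0, 0)) (mxtens_index (i, 0))).
  by rewrite tensmxE !mxE !eqxx mulr1.
rewrite unitmxE unitfE negbK => /det0P[v v0 vB].
have /(congr1 (mulmx^~ (invmx (A *t B)))) :
    (delta_mx 0 0 *t v : 'M[R]_(1 * 1, m.+1 * n.+1)) *m (A *t B) = 0.
  by rewrite tensmx_mul vB tensmx0.
rewrite mulmxK // mul0mx => vd; case/eqP: v0; apply/rowP => i.
move/matrixP: vd => /(_ (mxtens_index (0, 0)) (mxtens_index (0, i))).
by rewrite tensmxE !mxE !eqxx mul1r.
Qed.

Lemma kron_group_matrix_group p q : matrix_group (kron_group R p q).
Proof.
split.
- by move=> _ [[a b] [/= ua ub] <-]; have [] := invmx_tens ub ua.
- by exists (1%:M, 1%:M); [split; exact: unitmx1|exact: tens1mx].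
- move=> _ _ [[a b] [/= ua ub] <-] [[c d] [/= uc ud] <-].
  exists (a *m c, b *m d); first by split; rewrite /GL /= unitmx_mul ?ua ?ub.
  by rewrite /rho /= tensmx_mul.
- move=> _ [[a b] [/= ua ub] <-]; exists (invmx a, invmx b).
    by split; rewrite /GL /= unitmx_inv.
  by have [_] := invmx_tens ub ua.
Qed.

Lemma kron_group_self_adjoint p q : self_adjoint (kron_group R p q).
Proof.
move=> _ [[a b] [/= ua ub] <-]; exists (a^T, b^T).
  by split; rewrite /GL /= unitmx_tr.
by rewrite /rho /= trmx_tens.
Qed.

Lemma kron_group_scalar_closed p q : scalar_closed (kron_group R p q).
Proof.
move=> c _ c0 [[a b] [/= ua ub] <-]; exists (a, c *: b).
  by split => //; rewrite /GL /= unitmxZ // unitfE.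
by rewrite /rho /= -[a]scale1r tensmxZ scale1r mulr1.
Qed.

(** A 2 x 2 minor of the q^2 x p^2 matrix whose entry at ((i, j), (k, l)) is
    the one of the argument at ((i, k), (j, l)).  The argument is a Kronecker
    product exactly when this matrix has rank at most 1. *)
Definition rank_one_minor p q (i i' j j' : 'I_q) (k k' l l' : 'I_p) :
    mpoly.mpoly (q * p * (q * p)) R :=
  let X i k j l := mpoly.mpolyX R (mpoly.mnm1
    (mxvec_index (mxtens_index (i, k)) (mxtens_index (j, l)))) in
  X i k j l * X i' k' j' l' - X i k' j l' * X i' k j' l.

Lemma meval_rank_one_minor p q i i' j j' k k' l l' (M : 'M[R]_(q * p)) :
  mpoly.meval (fun a => mxvec M 0 a) (@rank_one_minor p q i i' j j' k k' l l') =
  M (mxtens_index (i, k)) (mxtens_index (j, l)) *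
    M (mxtens_index (i', k')) (mxtens_index (j', l')) -
  M (mxtens_index (i, k')) (mxtens_index (j, l')) *
    M (mxtens_index (i', k)) (mxtens_index (j', l)).
Proof.
by rewrite mpoly.mevalB !mpoly.mevalM !mpoly.mevalXU !mxvecE.
Qed.

(** If the minors vanish, then the row and the column through a nonzero
    entry of the reshuffled matrix give the two factors. *)
Lemma kron_group_zariski_closed p q : (0 < p)%N -> (0 < q)%N ->
  zariski_closed (kron_group R p q).
Proof.
move=> p_gt0 q_gt0.
exists [set f | exists i i' j j' k k' l l',
  f = @rank_one_minor p q i i' j j' k k' l l'].
rewrite eqEsubset; split=> [_ [[a b] [/= ua ub] <-]|M [uM Mminor]].
  split; first by have [] := invmx_tens ub ua.
  move=> _ [i [i' [j [j' [k [k' [l [l' ->]]]]]]]].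
  by rewrite meval_rank_one_minor /rho /= !tensmxE; ring.
have qp_gt0 : (0 < q * p)%N by rewrite muln_gt0 q_gt0.
have [i0 [k0 [j0 [l0 c0]]]] : exists i k j l,
    M (mxtens_index (i, k)) (mxtens_index (j, l)) != 0.
  apply: contrapT => nM; have M0 : M = 0.
    apply/matrixP => i j; rewrite mxE.
    case: (mxtens_indexP i) => i1 i2; case: (mxtens_indexP j) => j1 j2.
    by apply: contrapT => /eqP Mij; apply: nM; exists i1, i2, j1, j2.
  move: uM; rewrite M0 unitmxE.
  by case: (q * p)%N qp_gt0 => // n _; rewrite det0 unitr0.
set c := M _ _ in c0.
pose A2 : 'M[R]_q := \matrix_(i, j) M (mxtens_index (i, k0)) (mxtens_index (j,
  l0)).
pose A1 : 'M[R]_p := \matrix_(k, l)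
  (c^-1 * M (mxtens_index (i0, k)) (mxtens_index (j0, l))).
have ME : A2 *t A1 = M.
  apply/matrixP => i j.
  case: (mxtens_indexP i) => i1 i2; case: (mxtens_indexP j) => j1 j2.
  rewrite tensmxE !mxE.
  have Mc : M (mxtens_index (i1, i2)) (mxtens_index (j1, j2)) * c =
      M (mxtens_index (i1, k0)) (mxtens_index (j1, l0)) *
      M (mxtens_index (i0, i2)) (mxtens_index (j0, j2)).
    apply/eqP; rewrite -subr_eq0 -meval_rank_one_minor; apply/eqP/Mminor.
    by exists i1, i0, j1, j0, i2, k0, j2, l0.
  by rewrite mulrCA -Mc mulrC mulfK.
have [uA2 uA1] : A2 \in unitmx /\ A1 \in unitmx.
  by apply: unitmx_tens => //; rewrite ME.
by exists (A1, A2).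
Qed.

(** The tensor product of two exponentials is the exponential with
    eigenvalues the sums of an eigenvalue of each. *)
Lemma det_tens_posexp p q (l1 : 'M[R]_p) (l2 : 'M[R]_q)
    (x1 : 'rV[R]_p) (x2 : 'rV[R]_q) :
  orthogonal_mx l1 -> orthogonal_mx l2 ->
  \sum_i x1 0 i = 0 -> \sum_j x2 0 j = 0 ->
  \det (posexp l2 x2 *t posexp l1 x1) = 1.
Proof.
move=> ol1 ol2 sx1 sx2.
have ol : orthogonal_mx (l2 *t l1).
  by rewrite /orthogonal_mx trmx_tens tensmx_mul ol1 ol2 tens1mx.
pose x : 'rV[R]_(q * p) :=
  \row_r (x2 0 (mxtens_unindex r).1 + x1 0 (mxtens_unindex r).2).
have -> : posexp l2 x2 *t posexp l1 x1 = posexp (l2 *t l1) x.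
  rewrite /posexp trmx_tens -!tensmx_mul; congr (_ *m _ *m _).
  apply/matrixP => i j.
  case: (mxtens_indexP i) => i1 i2; case: (mxtens_indexP j) => j1 j2.
  rewrite tensmxE !mxE !mxtens_indexK /= (can_eq (@mxtens_indexK q p))
    xpair_eqE.
  by case: eqP => [->|_]; case: eqP => [->|_];
    rewrite ?mulr1n ?mulr0n ?mul0r ?mulr0 // expRD.
rewrite det_posexp //.
have -> : \sum_r x 0 r = 0; last by rewrite expR0.
rewrite (reindex (@mxtens_index q p)) /=; last first.
  by exists (@mxtens_unindex q p) => r _;
    [exact: mxtens_indexK|exact: mxtens_unindexK].
rewrite (eq_bigr (fun r => x2 0 r.1 + x1 0 r.2)) => [|[i k] _]; last first.
  by rewrite mxE mxtens_indexK.
rewrite -(pair_bigA _ (fun i k => x2 0 i + x1 0 k)) /=.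
under eq_bigr do rewrite big_split /= sx1 addr0.
by rewrite exchange_big /= big1.
Qed.

End KroneckerGroup.

(** * From general to special linear groups *)

Section SpecialLinearReduction.
Variables (R : realType) (p q : nat).
Local Notation pairmx := ('M[R]_p * 'M[R]_q)%type.

Definition gram (B : pairmx) : 'M[R]_(q * p) :=
  (B.2^T *m B.2) *t (B.1^T *m B.1).

Lemma gram_rho (A : pairmx) : (rho A)^T *m rho A = gram A.
Proof. by rewrite /rho trmx_tens tensmx_mul. Qed.

Lemma orthogonal_gram n (k g : 'M[R]_n) : orthogonal_mx k ->
  (k *m g)^T *m (k *m g) = g^T *m g.
Proof.
by move=> ok; rewrite trmx_mul -!mulmxA (mulmxA k^T) (orthogonal_mxV ok) mul1mx.
Qed.

Lemma gram_mul_orthogonal (k B : pairmx) : pair_orthogonal k ->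
  gram (pair_mul k B) = gram B.
Proof. by move=> [k1 k2]; rewrite /gram /= !orthogonal_gram. Qed.

Lemma det_gram (B : pairmx) : SLSL R p q B -> \det (gram B) = 1.
Proof.
move=> /pair_polar[k [l [x [[ko _] [l1 l2] [x1 x2] ->]]]].
rewrite gram_mul_orthogonal // /gram /= !posexp_tr !posexpD //.
apply: det_tens_posexp => //.
  by rewrite (eq_bigr _ (fun i _ => mxE _ _ _ _)) big_split /= x1 addr0.
by rewrite (eq_bigr _ (fun i _ => mxE _ _ _ _)) big_split /= x2 addr0.
Qed.

(** Subtracting the mean of the eigenvalues of the logarithm of A^T A leaves a
    matrix of trace 0, whose half is the logarithm of [B]. *)
Lemma gram_SL_rescale n (A : 'M[R]_n) : (0 < n)%N -> A \in unitmx ->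
  exists c (B : 'M[R]_n), [/\ 0 < c, \det B = 1 & A^T *m A = c *: (B^T *m B)].
Proof.
move=> n_gt0 uA; have [l [x [ol ->]]] := gram_posexp uA.
pose s := (\sum_i x 0 i) / n%:R.
pose y : 'rV[R]_n := 2^-1 *: (x - const_mx s).
have y0 : \sum_i y 0 i = 0.
  rewrite (eq_bigr (fun i => 2^-1 * (x 0 i - s))) => [|i _];
    last by rewrite !mxE.
  rewrite -mulr_sumr sumrB sumr_const card_ord -[s *+ n]mulr_natr /s divfK
    ?subrr ?mulr0 //.
  by rewrite pnatr_eq0 -lt0n.
exists (expR s), (posexp l y); split; first exact: expR_gt0.
  by rewrite det_posexp // y0 expR0.
rewrite posexp_tr posexpD // /posexp scalemxAl scalemxAr; congr (_ *m _ *m _).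
apply/matrixP => i j; rewrite !mxE; case: eqP => _;
  last by rewrite !mulr0n mulr0.
by rewrite !mulr1n -expRD; congr expR; field.
Qed.

End SpecialLinearReduction.

(** * The likelihood in terms of the special linear groups *)

Section Likelihood.
Variables (R : realType) (p q N : nat).
Hypotheses (p_gt0 : (0 < p)%N) (q_gt0 : (0 < q)%N).
Variables (X : 'I_N -> 'M[R]_(p, q)) (W : 'I_N -> R).
Hypothesis W_gt0 : forall k, 0 < W k.
Local Notation pairmx := ('M[R]_p * 'M[R]_q)%type.
Local Notation XW := (rescaled X W).
Local Notation GLGL := (GL R p `*` GL R q).

Definition SL_norm (B : pairmx) : R := sqnorm (left_right B XW).

Definition profile (alpha : R) (B : pairmx) : R :=
  (p * q * N)%:R * ln alpha - alpha * SL_norm B.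

Lemma loglik_gramE (A B : pairmx) (c1 c2 : R) : 0 < c1 -> 0 < c2 ->
  SLSL R p q B -> A.1^T *m A.1 = c1 *: (B.1^T *m B.1) ->
  A.2^T *m A.2 = c2 *: (B.2^T *m B.2) ->
  loglik_gram X W A = profile (c2 * c1) B.
Proof.
move=> c1_gt0 c2_gt0 hB A1 A2.
rewrite /loglik_gram /loglik A1 A2 tensmxZ detZ -/(gram B) det_gram // mulr1.
rewrite lnXn ?mulr_gt0 // /profile -[ln _ *+ _]mulr_natl mulrA -natrM;
  congr (_ - _).
  by congr (_%:R * _); rewrite mulnC (mulnC q).
rewrite /SL_norm sqnorm_tr mulr_sumr; apply: eq_bigr => k _.
have -> : left_right B XW k = (Num.sqrt (W k))^-1 *: (B.1 *m X k *m B.2^T).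
  by rewrite /left_right /rescaled -scalemxAr -scalemxAl.
have scaleMT (s : R) (M : 'M[R]_(p, q)) :
    (s *: M) *m (s *: M)^T = (s ^+ 2) *: (M *m M^T).
  by rewrite [(s *: M)^T]linearZ /= -scalemxAl -scalemxAr scalerA expr2.
have scale4 (a b : R) (P : 'M[R]_q) (Q : 'M[R]_(q, p)) (S : 'M[R]_p)
      (T : 'M[R]_(p, q)) :
    (a *: P) *m Q *m (b *: S) *m T = (a * b) *: (P *m Q *m S *m T).
  by rewrite -!scalemxAl -scalemxAr -!scalemxAl scalerA.
rewrite scaleMT scale4 !mxtraceZ exprVn sqr_sqrtr ?ltW //.
have -> : B.1 *m X k *m B.2^T *m (B.1 *m X k *m B.2^T)^T =
    (B.1 *m X k) *m (B.2^T *m B.2 *m (X k)^T *m B.1^T).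
  by rewrite !trmx_mul trmxK !mulmxA.
rewrite (mxtrace_mulC (B.1 *m X k)) !mulmxA; ring.
Qed.

Lemma GL_to_SL A : GLGL A -> exists B alpha, [/\ SLSL R p q B, 0 < alpha,
  gram A = alpha *: gram B & loglik_gram X W A = profile alpha B].
Proof.
case: A => a b [/= ua ub].
have [c1 [B1 [c1_gt0 dB1 aB]]] := gram_SL_rescale p_gt0 ua.
have [c2 [B2 [c2_gt0 dB2 bB]]] := gram_SL_rescale q_gt0 ub.
exists (B1, B2), (c2 * c1); split => //; first by rewrite mulr_gt0.
  by rewrite /gram /= aB bB tensmxZ.
exact: loglik_gramE.
Qed.

Lemma SL_to_GL B alpha : SLSL R p q B -> 0 < alpha -> exists A, [/\ GLGL A,
  gram A = alpha *: gram B & loglik_gram X W A = profile alpha B].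
Proof.
move=> hB a_gt0; have [uB1 uB2] := SLSL_unit hB.
pose A : pairmx := (Num.sqrt alpha *: B.1, B.2).
have s_gt0 : 0 < Num.sqrt alpha by rewrite sqrtr_gt0.
have A1 : A.1^T *m A.1 = alpha *: (B.1^T *m B.1).
  rewrite /A /= [(_ *: _)^T]linearZ /= -scalemxAl -scalemxAr scalerA -expr2.
  by rewrite sqr_sqrtr ?ltW.
have A2 : A.2^T *m A.2 = 1 *: (B.2^T *m B.2) by rewrite scale1r.
exists A; split; first by split; rewrite /GL //= unitmxZ ?unitfE ?gt_eqF.
  by rewrite {1}/gram A1 A2 tensmxZ mul1r.
by rewrite (loglik_gramE a_gt0 ltr01 hB A1 A2) mul1r.
Qed.

Definition maximizer alpha B := [/\ SLSL R p q B, 0 < alpha &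
  forall beta C, SLSL R p q C -> 0 < beta -> profile beta C <= profile alpha B].

Lemma is_MLE_maximizer Psi : is_MLE X W Psi <->
  exists B alpha, maximizer alpha B /\ Psi = alpha *: gram B.
Proof.
split=> [[A [hA -> Amax]]|[B [alpha [[hB a_gt0 Bmax] ->]]]].
  have [B [alpha [hB a_gt0 AB lA]]] := GL_to_SL hA.
  exists B, alpha; split; last by rewrite gram_rho.
  split=> // beta C hC b_gt0.
  by have [D [hD _ <-]] := SL_to_GL hC b_gt0; rewrite -lA Amax.
have [A [hA AB lA]] := SL_to_GL hB a_gt0.
exists A; split => //; first by rewrite gram_rho AB.
move=> D hD; have [C [beta [hC b_gt0 _ ->]]] := GL_to_SL hD.
by rewrite lA Bmax.
Qed.

Lemma norm_minimizerE B : norm_minimizer X W B <->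
  SLSL R p q B /\ forall C, SLSL R p q C -> SL_norm B <= SL_norm C.
Proof.
split=> -[hB Bmin]; split=> // C hC; first by rewrite -ler_frob_norm Bmin.
by rewrite ler_frob_norm Bmin.
Qed.

Definition SL_inf : R := inf [set SL_norm B | B in SLSL R p q].

Lemma SL_norm_has_inf : has_inf [set SL_norm B | B in SLSL R p q].
Proof.
split; first by exists (SL_norm (pair_one R p q)), (pair_one R p q) => //;
  exact: SLSL1.
by exists 0 => _ [B _ <-]; exact: sqnorm_ge0.
Qed.

Lemma SL_inf_le B : SLSL R p q B -> SL_inf <= SL_norm B.
Proof. by move=> hB; apply: inf_lbound; [case: SL_norm_has_inf|exists B]. Qed.

Lemma SL_inf_adherent e : 0 < e ->
  exists2 B, SLSL R p q B & SL_norm B < SL_inf + e.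
Proof.
by move=> /(inf_adherent)/(_ SL_norm_has_inf)[_ [B hB <-] lt_B]; exists B.
Qed.

Lemma norm_minimizer_inf B : norm_minimizer X W B -> SL_norm B = SL_inf.
Proof.
move=> /norm_minimizerE[hB Bmin]; apply/le_anti; rewrite SL_inf_le // andbT.
apply: lb_le_inf; first by case: SL_norm_has_inf.
by move=> _ [C hC <-]; exact: Bmin.
Qed.

Lemma inner_infE : inner_inf X W = SL_inf%:E.
Proof.
rewrite /inner_inf.
have -> : [set ((frob_norm (left_right B XW)) ^+ 2)%:E | B in SLSL R p q] =
    [set x%:E | x in [set SL_norm B | B in SLSL R p q]].
  rewrite image_comp; apply: eq_imagel => B _ /=.
  by rewrite sqr_frob_norm.
by rewrite ereal_inf_EFin //; case: SL_norm_has_inf.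
Qed.

Lemma outer_objE alpha :
  outer_obj X W alpha = (alpha * SL_inf - (p * q * N)%:R * ln alpha)%:E.
Proof. by rewrite /outer_obj inner_infE -EFinM -EFinB. Qed.

End Likelihood.

(** * Minimal vectors of one orbit *)

Section KempfNessUniqueness.
Variables (R : realType) (p q N : nat).
Local Notation pairmx := ('M[R]_p * 'M[R]_q)%type.
Local Notation pairrV := ('rV[R]_p * 'rV[R]_q)%type.

(** The polar decomposition of an element that moves a minimal vector to a
    minimal vector: by rigidity its exponential factor fixes the vector. *)
Lemma minimal_vector_polar (w : mxtuple R p q N) (g : pairmx) :
  minimal_vector w -> SLSL R p q g -> sqnorm (left_right g w) <= sqnorm w ->
  exists (k l : pairmx) (x : pairrV), [/\ pair_orthogonal k, pair_orthogonal l,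
    traceless x, g = pair_mul k (pair_posexp l x)
    & forall s, left_right (pair_posexp l (s *: x)) w = w].
Proof.
move=> wmin gSL; have [k [l [x [[ko _] lo x0 ->]]]] := pair_polar gSL.
rewrite left_rightM sqnorm_orthogonal // => gw.
by exists k, l, x; split => //; exact: minimal_vector_rigid.
Qed.

Lemma pair_posexp_scale_inj (l : pairmx) (x : pairrV) : pair_orthogonal l ->
  x != 0 -> injective (fun s => pair_posexp l (s *: x)).
Proof.
case: x => y z [l1 l2] x_neq0 s t st; apply: contraNeq x_neq0 => s_neq_t.
have zero n (h : 'M[R]_n) (u : 'rV[R]_n) : orthogonal_mx h ->
    posexp h (s *: u) = posexp h (t *: u) -> u = 0.
  move=> oh hu.
  have hst : diag_mx (map_mx (@expR R) (s *: u)) =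
      diag_mx (map_mx (@expR R) (t *: u)).
    rewrite -(orthogonal_conj_posexp (s *: u) oh) hu.
    exact: orthogonal_conj_posexp.
  apply/rowP => i; move/matrixP: hst => /(_ i i).
  rewrite !mxE eqxx !mulr1n => /expR_inj/eqP.
  by rewrite -subr_eq0 -mulrBl mulf_eq0 subr_eq0 (negbTE s_neq_t) => /eqP.
have y0 : y = 0 := zero _ _ _ l1 (congr1 fst st).
have z0 : z = 0 := zero _ _ _ l2 (congr1 snd st).
by rewrite y0 z0.
Qed.

Lemma sqnorm_left_right_eq0 (v : mxtuple R p q N) (B : pairmx) :
  SLSL R p q B -> sqnorm (left_right B v) = 0 -> v = (fun=> 0).
Proof.
move=> hB /sqnorm_eq0 /(left_rightK hB) <-; apply/funext => k.
by rewrite /left_right mulmx0 mul0mx.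
Qed.

Lemma left_right0 (B : pairmx) :
  left_right B ((fun=> 0) : mxtuple R p q N) = (fun=> 0).
Proof. by apply/funext => k; rewrite /left_right mulmx0 mul0mx. Qed.

Lemma sqnorm0 : sqnorm ((fun=> 0) : mxtuple R p q N) = 0.
Proof. by do 3 (apply: big1 => ? _); rewrite mxE expr0n. Qed.

Lemma orbit_left_right (v : mxtuple R p q N) (B : pairmx) : SLSL R p q B ->
  Defs.orbit (SLSL R p q) left_right (left_right B v) =
  Defs.orbit (SLSL R p q) left_right v.
Proof.
move=> hB; rewrite eqEsubset; split=> _ [C hC <-].
  by exists (pair_mul C B); [exact: SLSLM|rewrite left_rightM].
exists (pair_mul C (pair_inv B)); first by apply: SLSLM => //; exact: SLSLV.
by rewrite left_rightM (left_rightK hB erefl).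
Qed.

End KempfNessUniqueness.

(** * Maximization over the scale *)

Section OuterProblem.
Variable R : realType.
Implicit Types (K m a b : R).

(** The strictness is what makes the optimal scale unique. *)
Lemma ln_lt_subr1 (x : R) : 0 < x -> x != 1 -> ln x < x - 1.
Proof.
move=> x_gt0 x1; have lnx : ln x != 0 by rewrite ln_eq0.
have := expR_gt1Dx lnx; rewrite lnK ?posrE //; lra.
Qed.

(** The gap is K (r - 1 - ln r) with r = a m / K. *)
Lemma outer_gap K m a : 0 < K -> 0 < m -> 0 < a -> a != K / m ->
  K * ln a - a * m < K * ln (K / m) - K / m * m.
Proof.
move=> K_gt0 m_gt0 a_gt0 aKm; pose x := a * m / K.
have x_gt0 : 0 < x by rewrite divr_gt0 ?mulr_gt0.
have aE : a = K / m * x by rewrite /x; field; rewrite !gt_eqF.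
have x1 : x != 1 by apply: contra aKm => /eqP x1; rewrite aE x1 mulr1.
have lnx := ln_lt_subr1 x_gt0 x1.
rewrite aE [ln (K / m * x)]lnM ?posrE ?divr_gt0 ?mulr_gt0 //
  mulrDr -addrA ltrD2l.
have -> : K / m * x * m = K * x by field; rewrite gt_eqF.
have -> : K / m * m = K by field; rewrite gt_eqF.
by have := lnx; rewrite -(ltr_pM2l K_gt0) mulrBr mulr1; lra.
Qed.

Lemma outer_max K m a : 0 < K -> 0 < m -> 0 < a ->
  K * ln a - a * m <= K * ln (K / m) - K / m * m.
Proof.
move=> K_gt0 m_gt0 a_gt0; have [->//|aKm] := eqVneq a (K / m).
exact/ltW/outer_gap.
Qed.

End OuterProblem.

(** * Maximum likelihood estimation and stability *)

Section MaximumLikelihood.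
Variables (R : realType) (p q N : nat).
Hypotheses (p_gt0 : (0 < p)%N) (q_gt0 : (0 < q)%N) (N_gt0 : (0 < N)%N).
Variables (X : 'I_N -> 'M[R]_(p, q)) (W : 'I_N -> R).
Hypothesis W_gt0 : forall k, 0 < W k.
Local Notation pairmx := ('M[R]_p * 'M[R]_q)%type.
Local Notation XW := (rescaled X W).
Local Notation GLGL := (GL R p `*` GL R q).
Local Notation H := (SLSL R p q).
Local Notation K := ((p * q * N)%:R : R).
Local Notation n := (SL_norm X W).
Local Notation m := (SL_inf X W).
Local Notation loglik_values := [set loglik_gram X W A | A in GLGL].

Let K_gt0 : 0 < K.
Proof. by rewrite ltr0n !muln_gt0 p_gt0 q_gt0. Qed.

Lemma SL_inf_ge0 : 0 <= m.
Proof.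
by apply: lb_le_inf; [case: (SL_norm_has_inf X W)|move=> _ [B _ <-];
  exact: sqnorm_ge0].
Qed.

Lemma outer_minimizerE alpha : outer_minimizer X W alpha <->
  0 < alpha /\
  forall beta, 0 < beta -> alpha * m - K * ln alpha <= beta * m - K * ln beta.
Proof.
split=> -[a_gt0 amin]; split=> // beta b_gt0.
  by have := amin _ b_gt0; rewrite !outer_objE lee_fin.
by rewrite !outer_objE lee_fin amin.
Qed.

Lemma profile_le alpha B : 0 < alpha -> H B ->
  profile X W alpha B <= K * ln alpha - alpha * m.
Proof.
by move=> a_gt0 hB; rewrite lerD2l lerN2 ler_wpM2l ?(ltW a_gt0) ?SL_inf_le.
Qed.

Lemma sup_loglik : ereal_sup [set (loglik_gram X W A)%:E | A in GLGL] =
  (- ereal_inf [set outer_obj X W alpha | alpha in [set a : R | (0 < a)%R]])%E.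
Proof.
apply/le_anti/andP; split.
  apply: ge_ereal_sup => _ [A hA <-].
  have [B [alpha [hB a_gt0 _ ->]]] := GL_to_SL p_gt0 q_gt0 X W_gt0 hA.
  rewrite leeNr; apply: ge_ereal_inf; exists (outer_obj X W alpha);
    first by exists alpha.
  by rewrite outer_objE -EFinN lee_fin; have := profile_le a_gt0 hB; lra.
rewrite leeNl; apply: le_ereal_inf_tmp => _ [alpha /= a_gt0 <-].
rewrite outer_objE leeNl -EFinN; apply/lee_addgt0Pr => e e_gt0.
have [B hB nB] := SL_inf_adherent X W (divr_gt0 e_gt0 a_gt0).
have [A [hA _ lA]] := SL_to_GL X W_gt0 hB a_gt0.
apply: (@le_trans _ _ ((loglik_gram X W A)%:E + e%:E)%E); last first.
  by rewrite leeD2r //; apply: ereal_sup_ubound; exists A.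
rewrite lA -EFinD lee_fin /profile.
move: nB; rewrite -(ltr_pM2l a_gt0) mulrDr mulrC [alpha * (e / _)]mulrC divfK
  ?gt_eqF //.
by lra.
Qed.

Lemma maximizer_norm_minimizer alpha B :
  maximizer X W alpha B -> norm_minimizer X W B.
Proof.
move=> [hB a_gt0 Bmax]; apply/norm_minimizerE; split=> // C hC.
by have := Bmax alpha C hC a_gt0; rewrite lerD2l lerN2 ler_pM2l.
Qed.

Lemma maximizerP alpha B : maximizer X W alpha B <->
  norm_minimizer X W B /\ outer_minimizer X W alpha.
Proof.
split=> [aB|[Bmin /outer_minimizerE[a_gt0 amin]]].
  have [hB a_gt0 Bmax] := aB; have Bmin := maximizer_norm_minimizer aB.
  split=> //; apply/outer_minimizerE; split=> // beta b_gt0.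
  have := Bmax _ _ hB b_gt0; rewrite /profile (norm_minimizer_inf Bmin); lra.
have [hB _] := iffLR (norm_minimizerE X W B) Bmin.
split=> // beta C hC b_gt0; apply: le_trans (profile_le b_gt0 hC) _.
by rewrite /profile (norm_minimizer_inf Bmin); have := amin _ b_gt0; lra.
Qed.

Lemma is_MLEP Psi : is_MLE X W Psi <->
  exists B (alpha : R), [/\ norm_minimizer X W B, outer_minimizer X W alpha
    & Psi = alpha *: gram B].
Proof.
rewrite (is_MLE_maximizer p_gt0 q_gt0 X W_gt0); split.
  by move=> [B [alpha [/maximizerP[? ?] ?]]]; exists B, alpha.
by move=> [B [alpha [? ? ?]]]; exists B, alpha; split=> //; exact/maximizerP.
Qed.

Lemma outer_minimizer_gt0 alpha : outer_minimizer X W alpha -> 0 < m.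
Proof.
move=> /outer_minimizerE[a_gt0 amin]; rewrite lt0r SL_inf_ge0 andbT.
apply/eqP => m0; have a2_gt0 : 0 < 2 * alpha by rewrite mulr_gt0.
have := amin _ a2_gt0; rewrite m0 !mulr0 !add0r lerN2 ler_pM2l //.
by rewrite ler_ln ?posrE //; lra.
Qed.

Lemma outer_minimizer_unique alpha : outer_minimizer X W alpha -> alpha = K / m.
Proof.
move=> aP; have m_gt0 := outer_minimizer_gt0 aP.
have /outer_minimizerE[a_gt0 amin] := aP.
apply/eqP; apply: contraT => aKm.
have := outer_gap K_gt0 m_gt0 a_gt0 aKm.
by have := amin (K / m) (divr_gt0 K_gt0 m_gt0); lra.
Qed.

Lemma outer_minimizer_exists : 0 < m -> outer_minimizer X W (K / m).
Proof.
move=> m_gt0; apply/outer_minimizerE; split; first exact: divr_gt0.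
by move=> b b_gt0; have := outer_max K_gt0 m_gt0 b_gt0; lra.
Qed.

Lemma norm_minimizer_minimal_vector B :
  norm_minimizer X W B -> minimal_vector (left_right B XW).
Proof.
move=> /norm_minimizerE[hB Bmin] C hC; rewrite -left_rightM.
exact/Bmin/SLSLM.
Qed.

(** With C B^-1 = k exp(x), the orthogonal factor k disappears in the Gram
    matrix of C, and exp(s x) fixes B.X^W, so its conjugate by B stabilizes
    X^W. *)
Lemma norm_minimizers_polar B C : norm_minimizer X W B ->
  norm_minimizer X W C ->
  exists (l : pairmx) (x : 'rV[R]_p * 'rV[R]_q),
  [/\ pair_orthogonal l,
      forall s, stabilizer H left_right XW
        (pair_mul (pair_inv B) (pair_mul (pair_posexp l (s *: x)) B))
    & gram C = gram (pair_mul (pair_posexp l x) B)].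
Proof.
move=> Bmin Cmin; have /norm_minimizerE[hB Bmin'] := Bmin.
have /norm_minimizerE[hC Cmin'] := Cmin; have hBV := SLSLV hB.
have gSL : H (pair_mul C (pair_inv B)) by exact: SLSLM.
have [|k [l [x [ko lo x0 gE fixw]]]] :=
    minimal_vector_polar (norm_minimizer_minimal_vector Bmin) gSL.
  by rewrite left_rightM (left_rightK hB erefl) Cmin'.
exists l, x; split=> // [s|].
  split; last by rewrite !left_rightM fixw (left_rightK hB erefl).
  by do 2 (apply: SLSLM => //); apply: SLSL_posexp => //;
    exact: traceless_scale.
have -> : C = pair_mul k (pair_mul (pair_posexp l x) B).
  by rewrite pair_mul_assoc -gE -pair_mul_assoc pair_Vmul // pair_mul1.
by rewrite gram_mul_orthogonal.
Qed.

(** The given scale [alpha] is the optimal one because the Gram matrices have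
    determinant 1. *)
Lemma MLE_orbit B alpha Psi : norm_minimizer X W B -> 0 < alpha ->
  is_MLE X W (alpha *: gram B) -> is_MLE X W Psi ->
  exists2 S, stabilizer H left_right XW S & Psi = alpha *: gram (pair_mul B S).
Proof.
move=> Bmin a_gt0 /is_MLEP[B' [a' [Bmin' amin' BB']]].
move=> /is_MLEP[C [c [Cmin cmin ->]]].
have /norm_minimizerE[hB _] := Bmin; have /norm_minimizerE[hB' _] := Bmin'.
have -> : c = alpha.
  rewrite (outer_minimizer_unique cmin) -(outer_minimizer_unique amin').
  have := congr1 determinant BB'; rewrite !detZ !det_gram // !mulr1 => /eqP.
  rewrite eqrXn2 ?(ltW a_gt0) ?muln_gt0 ?q_gt0 //; first by move=> /eqP.
  by case: amin' => /ltW.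
have [l [x [lo stab gC]]] := norm_minimizers_polar Bmin Cmin.
exists (pair_mul (pair_inv B) (pair_mul (pair_posexp l x) B)).
  by have := stab 1; rewrite scale1r.
by rewrite gC pair_mul_assoc pair_mulV // pair_1mul.
Qed.

Lemma unstable_SL_norm : unstable H left_right XW <->
  forall e, 0 < e -> exists2 B, H B & n B < e.
Proof.
rewrite /unstable closure_sqnormP; split=> P0 e /P0.
  move=> [_ [B hB <-]]; rewrite (_ : (fun k => _) = left_right B XW);
    first by exists B.
  by apply/funext => k; rewrite subr0.
move=> [B hB nB]; exists (left_right B XW); first by exists B.
by rewrite (_ : (fun k => _) = left_right B XW) //; apply/funext => k;
  rewrite subr0.
Qed.

(** With n(B) < 1 / alpha the log-likelihood exceeds K ln alpha - 1, which is
    arbitrarily large; if n is bounded below by e > 0, the maximum over the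
    scale with m = e is an upper bound. *)
Lemma unstable_unbounded :
  unstable H left_right XW <-> ~ has_ubound loglik_values.
Proof.
rewrite unstable_SL_norm; split=> [n_small [M Mub]|unb e e_gt0].
  (* K >= 1, so this scale makes K ln a - 1 larger than M *)
  pose a := expR (`|M| + 2); have a_gt0 : 0 < a by exact: expR_gt0.
  have aV_gt0 : 0 < a^-1 by rewrite invr_gt0.
  have [B hB nB] := n_small _ aV_gt0.
  have [A [hA _ lA]] := SL_to_GL X W_gt0 hB a_gt0.
  have : loglik_gram X W A <= M by apply: Mub; exists A.
  rewrite lA /profile expRK; apply/negP; rewrite -ltNge.
  have anB : a * n B < 1 by rewrite -(mulfV (lt0r_neq0 a_gt0)) ltr_pM2l.
  have K_ge1 : 1 <= K by rewrite ler1n !muln_gt0 p_gt0 q_gt0.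
  have : `|M| + 2 <= K * (`|M| + 2) by rewrite ler_peMl // addr_ge0.
  by have := ler_norm M; lra.
apply: contrapT => n_large; apply: unb.
have n_ge B : H B -> e <= n B.
  by move=> hB; rewrite leNgt; apply/negP => nB; apply: n_large; exists B.
exists (K * ln (K / e) - K / e * e) => _ [A hA <-].
have [B [alpha [hB a_gt0 _ ->]]] := GL_to_SL p_gt0 q_gt0 X W_gt0 hA.
apply: le_trans (outer_max K_gt0 e_gt0 a_gt0).
by rewrite lerD2l lerN2 ler_wpM2l ?(ltW a_gt0) ?n_ge.
Qed.

Lemma polystable_MLE :
  polystable H left_right XW <-> exists Psi, is_MLE X W Psi.
Proof.
split=> [[XW0 Xcl]|[Psi /is_MLEP[B [alpha [Bmin amin _]]]]].
  have orbit0 : Defs.orbit H left_right XW !=set0.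
    by exists (left_right (pair_one R p q) XW), (pair_one R p q) => //;
      exact: SLSL1.
  have [_ [B hB <-] Bmin] := closed_min_attained orbit0 Xcl.
  have Bm : norm_minimizer X W B.
    by apply/norm_minimizerE; split=> // C hC; apply: Bmin; exists C.
  have m_gt0 : 0 < m.
    rewrite -(norm_minimizer_inf Bm) lt0r sqnorm_ge0 andbT; apply/eqP => nB0.
    by apply: XW0; exact: sqnorm_left_right_eq0 nB0.
  exists ((K / m) *: gram B); apply/is_MLEP; exists B, (K / m); split=> //.
  exact: outer_minimizer_exists.
have /norm_minimizerE[hB _] := Bmin.
split; last first.
  rewrite -(orbit_left_right _ hB); apply: minimal_vector_closed_orbit.
  exact: norm_minimizer_minimal_vector.
move=> XW0; have := outer_minimizer_gt0 amin.
by rewrite -(norm_minimizer_inf Bmin) /SL_norm XW0 left_right0 sqnorm0 ltxx.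
Qed.

(** If the element exp(x) relating two norm minimizers were not trivial, its
    integral powers would give infinitely many elements of the stabilizer. *)
Lemma stable_unique_MLE :
  stable H left_right XW -> exists! Psi, is_MLE X W Psi.
Proof.
move=> [/polystable_MLE[Psi PsiP] fin].
exists Psi; split=> // Phi /is_MLEP[C [c [Cmin cmin ->]]].
have /is_MLEP[B [b [Bmin bmin ->]]] := PsiP.
rewrite (outer_minimizer_unique cmin) (outer_minimizer_unique bmin).
congr (_ *: _); have /norm_minimizerE[hB _] := Bmin.
have [l [x [lo stab ->]]] := norm_minimizers_polar Bmin Cmin.
have [->|x0] := eqVneq x 0; first by rewrite pair_posexp0 // pair_1mul.
pose f (k : nat) := pair_mul (pair_inv B)
  (pair_mul (pair_posexp l (k%:R *: x)) B).
have f_inj : injective f.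
  have conjK (g : pairmx) :
      pair_mul (pair_mul B (pair_mul (pair_inv B) (pair_mul g B))) (pair_inv
        B) = g.
    rewrite (pair_mul_assoc B) (pair_mulV hB) pair_1mul -pair_mul_assoc.
    by rewrite (pair_mulV hB) pair_mul1.
  move=> i j fij; apply/eqP; rewrite -(eqr_nat R); apply/eqP.
  apply: (pair_posexp_scale_inj lo x0).
  transitivity (pair_mul (pair_mul B (f i)) (pair_inv B)).
    by rewrite /f conjK.
  by rewrite fij /f conjK.
exfalso; apply: infinite_nat.
have := finite_preimage (in2W f_inj : {in f @^-1` _ &, injective f}) fin.
by rewrite (_ : f @^-1` _ = setT) //; rewrite eqEsubset; split=> // k _;
  exact: stab.
Qed.

End MaximumLikelihood.

Theorem theorem4p5 (R : realType) (p q N : nat)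
    (p_ge1 : (1 <= p)%N) (q_ge1 : (1 <= q)%N) (N_ge1 : (1 <= N)%N)
    (X : 'I_N -> 'M[R]_(p, q)) (W : 'I_N -> R)
    (W_gt0 : forall k, 0 < W k) :
  let XW := rescaled X W in
  let G := kron_group R p q in
  let H := SLSL R p q in
  let act := @left_right R p q N in
  let GLGL := GL R p `*` GL R q in
  [/\ matrix_group G, zariski_closed G, self_adjoint G & scalar_closed G] /\
  ereal_sup [set (loglik_gram X W A)%:E | A in GLGL] =
    (- ereal_inf [set outer_obj X W alpha | alpha in [set a : R | (0 < a)%R]])%E /\
  (forall Psi, is_MLE X W Psi <->
     exists B (alpha : R), [/\ norm_minimizer X W B, outer_minimizer X W alpha
       & Psi = alpha *: ((B.2^T *m B.2) *t (B.1^T *m B.1))]) /\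
  ((exists Psi, is_MLE X W Psi) -> exists! alpha, outer_minimizer X W alpha) /\
  (forall B (alpha : R), norm_minimizer X W B -> 0 < alpha ->
     is_MLE X W (alpha *: ((B.2^T *m B.2) *t (B.1^T *m B.1))) ->
     forall Psi, is_MLE X W Psi -> exists2 S, stabilizer H act XW S &
       Psi = alpha *: ((S.2^T *m B.2^T *m B.2 *m S.2)
                       *t (S.1^T *m B.1^T *m B.1 *m S.1))) /\
  (unstable H act XW <-> ~ has_ubound [set loglik_gram X W A | A in GLGL]) /\
  (semistable H act XW <-> has_ubound [set loglik_gram X W A | A in GLGL]) /\
  (polystable H act XW <-> exists Psi, is_MLE X W Psi) /\
  (stable H act XW -> exists! Psi, is_MLE X W Psi).
Proof.
move=> XW G H act GLGL.
have unst := unstable_unbounded p_ge1 q_ge1 N_ge1 X W_gt0.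
split; first by split; [exact: kron_group_matrix_group|exact: kron_group_zariski_closed
  |exact: kron_group_self_adjoint|exact: kron_group_scalar_closed].
split; first exact: sup_loglik.
split; first by move=> Psi; exact: is_MLEP.
split.
  move=> [Psi /is_MLEP[]// B [alpha [_ amin _]]]; exists alpha; split=> // beta bmin.
  by rewrite (outer_minimizer_unique p_ge1 q_ge1 N_ge1 amin)
    (outer_minimizer_unique p_ge1 q_ge1 N_ge1 bmin).
split.
  move=> B alpha Bmin a_gt0 BMLE Psi PsiP.
  have [S stabS ->] := MLE_orbit p_ge1 q_ge1 N_ge1 W_gt0 Bmin a_gt0 BMLE PsiP.
  by exists S => //; rewrite /gram /= !trmx_mul !mulmxA.
split; first exact: unst.
split.
  rewrite /semistable -/(unstable H act XW); split=> [/unst/contrapT //|bd].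
  by move=> /unst; exact.
split; first exact: polystable_MLE.
exact: stable_unique_MLE.
Qed.
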